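(* For every $w\in W^{\Lambda_0}$, $$\mathcal{M}_w=\{A\in\mathcal{M}\mid\lambda(\mathrm{supp}(A))\subset\lambda(w)\}=\{A\in\mathcal{M}\mid w(\mathrm{supp}(A))\le w\}.$$
   Context: **Weights.** $\mathbb{Z}^\times=\mathbb{Z}\setminus\{0\}$; $\mathfrak{h}=\bigoplus_{i\in\mathbb{Z}^\times}\mathbb{C}E_{ii}$ is the Cartan subalgebra of $\mathfrak{gl}_\infty$ (complex $\mathbb{Z}^\times\times\mathbb{Z}^\times$ matrices of finite support), $\langle\epsilon_i,E_{jj}\rangle=\delta_{ij}$; $h_0=E_{-1,-1}-E_{11}$, $h_i=E_{ii}-E_{i+1,i+1}$, $h_{-i}=E_{-i-1,-i-1}-E_{-i,-i}$ and $\alpha_0=\epsilon_{-1}-\epsilon_1$, $\alpha_i=\epsilon_i-\epsilon_{i+1}$, $\alpha_{-i}=\epsilon_{-i-1}-\epsilon_{-i}$ ($i\ge1$). $\Lambda_0\in\mathfrak{h}^*$: $\langle\Lambda_0,E_{-i,-i}\rangle=-\langle\Lambda_0,E_{ii}\rangle=\frac12$ ($i\ge1$). **Words.** On the letters $1<2<3<\cdots$ let $\widetilde f_i(i)=i+1$, $\widetilde e_i(i+1)=i$ ($i>0$), all other values being the formal symbol $\mathbf 0$; on the letters $-1^\vee<-2^\vee<\cdots$ let $\widetilde f_{-i}(-i^\vee)=-(i+1)^\vee$, $\widetilde e_{-i}(-(i+1)^\vee)=-i^\vee$ ($i>0$), all other values being $\mathbf 0$. For a letter $b$, $\varepsilon_i(b)=1$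 if $\widetilde e_ib\ne\mathbf 0$ and $0$ otherwise, $\varphi_i(b)=1$ if $\widetilde f_ib\ne\mathbf 0$ and $0$ otherwise; for words, $\varepsilon_i(b)=\max\{k:\widetilde e_i^kb\ne\mathbf 0\}$, $\varphi_i(b)=\max\{k:\widetilde f_i^kb\neq\mathbf 0\}$. Words $w_1\cdots w_r$ are tensors $w_1\otimes\cdots\otimes w_r$, with the rule: $\widetilde f_i(b_1\otimes b_2)=\widetilde f_ib_1\otimes b_2$ if $\varphi_i(b_1)>\varepsilon_i(b_2)$ and $b_1\otimes\widetilde f_ib_2$ otherwise; $\widetilde e_i(b_1\otimes b_2)=\widetilde e_ib_1\otimes b_2$ if $\varphi_i(b_1)\ge\varepsilon_i(b_2)$ and $b_1\otimes\widetilde e_ib_2$ otherwise ($\mathbf 0\otimes b=b\otimes\mathbf 0=\mathbf 0$; the empty word is sent to $\mathbf 0$ by all operators). **$\mathcal{M}$ and its operators.** $\mathcal{M}$ is the set of matrices $A=(a_{-i^\vee,j})_{i,j\ge1}$ with entries in $\mathbb{Z}_{\ge0}$ and finite support; $\mathbb{O}$ is the zero matrix; $\mathrm{supp}(A)=\{(i,j)\in\mathbb{N}^2\mid a_{-i^\vee,j}\ne0\}$ ($\mathbb{N}=\{1,2,\dots\}$). To $A$ associate two-row words $(\mathbf i,\mathbf j)$ and $(\mathbf k,\mathbf l)$, each containing the pair $(-i^\vee,j)$ exactly $a_{-i^\vee,j}$ times: in $(\mathbf i,\mathbf j)$ the pairs $(i_m,j_m)$ are sorted so that $j_1\le j_2\le\cdots$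 and $i_m\ge i_{m+1}$ whenever $j_m=j_{m+1}$; in $(\mathbf k,\mathbf l)$ the pairs $(k_m,l_m)$ are sorted so that $k_1\le k_2\le\cdots$ and $l_m\ge l_{m+1}$ whenever $k_m=k_{m+1}$. For $i<0$, $\widetilde e_i,\widetilde f_i$ act on $A$ through $\mathbf i$ ($\mathbf j$ fixed; the result is again sorted or $\mathbf 0$); for $i>0$ through $\mathbf l$ ($\mathbf k$ fixed); and $\widetilde f_0A=A+E_{-1^\vee,1}$ with $E_{-1^\vee,1}$ the elementary matrix at position $(-1^\vee,1)$ ($\widetilde e_0A=A-E_{-1^\vee,1}$ if $a_{-1^\vee,1}\neq0$, else $\mathbf 0$). **Weyl group.** $W$ is generated by the simple reflections $s_i(\lambda)=\lambda-\langle\lambda,h_i\rangle\alpha_i$ ($i\in\mathbb{Z}$) on $\mathfrak{h}^*$; $s_i$ acts on $\mathbb{Z}^\times$ as the transposition $(i\;i{+}1)$ for $i>0$, $(i{-}1\;i)$ for $i<0$, $(-1\;1)$ for $i=0$. $\ell$ is the length and $\le$ the Bruhat order. $W_{\Lambda_0}=\langle s_i\mid i\ne0\rangle$ is the stabilizer of $\Lambda_0$, and $W^{\Lambda_0}=\{w\in W\mid\ell(ws_i)>\ell(w)\text{ for all }i\ne0\}$. For $w\in W^{\Lambda_0}$, $\lambda(w)$ is the partition with $\lambda(w)_i=|\{j\in\mathbb{Z}^\times\mid -i<w^{-1}(j),\ j<w(-i)\}|$ ($i\ge1$); $w\mapsto\lambda(w)$ is a bijection from $W^{\Lambda_0}$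 to the set of all partitions. **Demazure crystal.** For $w\in W^{\Lambda_0}$ with reduced expression $w=s_{i_1}\cdots s_{i_r}$, $\mathcal{M}_w=\{\widetilde f_{i_1}^{m_1}\cdots\widetilde f_{i_r}^{m_r}\mathbb{O}\mid m_1,\dots,m_r\ge0\}\setminus\{\mathbf 0\}$ (independent of the reduced expression). **$\lambda(S)$ and $w(S)$.** A partition $\lambda$ is identified with $\{(i,j)\in\mathbb{N}^2\mid 1\le j\le\lambda_i\}$. Frobenius notation: $\lambda=(\alpha_1,\dots,\alpha_d\mid\beta_1,\dots,\beta_d)$ where $d$ is the diagonal length, $\alpha_i=\lambda'_i-i+1$, $\beta_i=\lambda_i-i+1$ (diagonal box counted in both). For a nonempty finite $S\subset\mathbb{N}^2$, let $\lambda=(\alpha_1,\dots|\beta_1,\dots)$ be the smallest partition containing $S$; $\theta(S)=\{(i,j)\in\lambda\mid(i+1,j+1)\notin\lambda\}$ is its border strip, and $c(S)=(\alpha_1,\beta_1)$ (the largest row index and the largest column index occurring in $S$). Put $S^{(1)}=S$, $S^{(k+1)}=S^{(k)}\setminus\theta(S^{(k)})$, $c_k=(\alpha_k,\beta_k)=c(S^{(k)})$ for $1\le k\le d$, where $d$ is smallest with $S^{(d+1)}=\emptyset$. Then $\alpha_1>\alpha_2>\cdots$, $\beta_1>\beta_2>\cdots$, and $\lambda(S)$ is the partition $(\alpha_1,\dots,\alpha_d\mid\beta_1,\dots,\beta_d)$ in Frobenius notation with the diagonal box counted in both, i.e. $\lambda(S)$ is the partition of diagonal length $d$ with $\lambda(S)'_i-i+1=\alpha_i$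 and $\lambda(S)_i-i+1=\beta_i$ for $1\le i\le d$; $\lambda(\emptyset)=\emptyset$. $w(S)\in W^{\Lambda_0}$ is defined by $\lambda(w(S))=\lambda(S)$. *)

(* Defs.v *)
From Stdlib Require Import Relation_Operators.
From mathcomp Require Import all_boot all_order all_algebra finmap multiset.
From mathcomp Require Import boolp classical_sets functions cardinality reals.
From mathcomp Require Import complex.

Set Implicit Arguments.
Unset Strict Implicit.
Unset Printing Implicit Defensive.

Import Order.TTheory GRing.Theory Num.Theory.

Local Open Scope classical_set_scope.
Local Open Scope nat_scope.

Definition zx : Type := {z : int | z != 0%R}.

Definition zx1 : zx := exist _ 1%R isT.
(* [to_zx 0] is a dummy value; [to_zx] is only used at nonzero integers. *)
Definition to_zx (z : int) : zx := insubd zx1 z.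

(* A linear form on h = (+)_i C E_ii is determined by its arbitrary values on
   the basis (E_jj); the weight l is encoded by the function j |-> <l, E_jj>,
   and C is R[i] for R the real numbers. *)
Definition weight (R : realType) : Type := zx -> R[i].

Definition epsilon {R : realType} (i : zx) : weight R :=
  fun j => ((j == i)%:R)%R.

(* With (p, q) = root_indices i, one has h_i = E_pp - E_qq and
   alpha_i = epsilon_p - epsilon_q. *)
Definition root_indices (i : int) : zx * zx :=
  if i == 0%R then (to_zx (-1)%R, to_zx 1%R)
  else if (0 < i)%R then (to_zx i, to_zx (i + 1)%R)
  else (to_zx (i - 1)%R, to_zx i).

Definition simple_root {R : realType} (i : int) : weight R :=
  fun j => (epsilon (root_indices i).1 j - epsilon (root_indices i).2 j)%R.

Definition pairing_h {R : realType} (l : weight R) (i : int) : R[i] :=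
  (l (root_indices i).1 - l (root_indices i).2)%R.

Definition simple_refl {R : realType} (i : int) (l : weight R) : weight R :=
  fun j => (l j - pairing_h l i * simple_root i j)%R.

(* word_refl [:: i_1; ...; i_r] = s_{i_1} ... s_{i_r}; the leftmost factor is
   applied last. *)
Definition word_refl {R : realType} (s : seq int) : weight R -> weight R :=
  foldr (fun i f => simple_refl i \o f) id s.

(* The s_i are involutions, so products of the s_i form a group. *)
Definition weyl {R : realType} : set (weight R -> weight R) :=
  [set w | exists s, w = word_refl s].

(* The action of W on Z^x, determined by w (epsilon_j) = epsilon_(w j). *)
Definition weyl_act {R : realType} (w : weight R -> weight R) (j : zx) : zx :=
  xget j [set k | w (epsilon j) = epsilon k].

Definition weyl_act_inv {R : realType} (w : weight R -> weight R) (j : zx) :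
  zx :=
  xget j [set k | w (epsilon k) = epsilon j].

Definition weyl_length {R : realType} (w : weight R -> weight R) : nat :=
  xget 0 [set n | (exists2 s, w = word_refl s & size s = n) /\
                  (forall s, w = word_refl s -> n <= size s)].

Definition reduced_expr {R : realType} (w : weight R -> weight R)
  (s : seq int) : Prop :=
  w = word_refl s /\ size s = weyl_length w.

(* W^{Lambda_0}, the minimal length representatives of the cosets of
   <s_i | i != 0>, which is the stabilizer of Lambda_0. *)
Definition weyl_min {R : realType} : set (weight R -> weight R) :=
  [set w | weyl w /\
     forall i : int, i != 0%R -> weyl_length w < weyl_length (w \o simple_refl i)].

(* The reflections u s_i u^-1, where u = s_{i_1} ... s_{i_r}. *)
Definition reflection {R : realType} : set (weight R -> weight R) :=
  [set t | exists s i, t = word_refl (s ++ i :: rev s)].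

Definition bruhat_step {R : realType} (u w : weight R -> weight R) : Prop :=
  weyl_length u < weyl_length w /\ exists2 t, reflection t & w = u \o t.

Definition bruhat {R : realType} (u w : weight R -> weight R) : Prop :=
  clos_refl_trans _ bruhat_step u w.

(* A partition is a function i |-> lambda_i of which only the values at i >= 1
   are meaningful; it is identified with its diagram, a subset of N x N. *)
Definition is_partition (l : nat -> nat) : Prop :=
  (forall i j, 0 < i -> i <= j -> l j <= l i) /\
  (exists n, forall i, n < i -> l i = 0).

Definition diagram (l : nat -> nat) : set (nat * nat) :=
  [set p | 0 < p.1 /\ 0 < p.2 <= l p.1].

Definition young : set (set (nat * nat)) :=
  [set D | exists2 l, is_partition l & D = diagram l].

Definition row_len (D : set (nat * nat)) (i : nat) : nat :=
  #|` fset_set [set j | D (i, j)]|.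

Definition col_len (D : set (nat * nat)) (j : nat) : nat :=
  #|` fset_set [set i | D (i, j)]|.

Definition diag_len (D : set (nat * nat)) : nat :=
  #|` fset_set [set i | D (i, i)]|.

(* The list of the (alpha_i, beta_i), with the diagonal box counted in both. *)
Definition frobenius (D : set (nat * nat)) : seq (nat * nat) :=
  [seq ((col_len D i - i).+1, (row_len D i - i).+1) | i <- iota 1 (diag_len D)].

Definition lambda_weyl {R : realType} (w : weight R -> weight R) :
  set (nat * nat) :=
  diagram (fun i => #|` fset_set
    [set j : zx | (- (i%:Z) < val (weyl_act_inv w j))%R /\
                  (val j < val (weyl_act w (to_zx (- (i%:Z)))))%R]|).

Definition border_strip (S : set (nat * nat)) : set (nat * nat) :=
  [set p | smallest young S p /\ ~ smallest young S (p.1.+1, p.2.+1)].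

Definition corner (S : set (nat * nat)) : nat * nat :=
  head (0, 0) (frobenius (smallest young S)).

(* [peel S k] is S^(k+1). *)
Definition peel (S : set (nat * nat)) (k : nat) : set (nat * nat) :=
  iter k (fun T => T `\` border_strip T) S.

(* The smallest d with S^(d+1) empty. *)
Definition peel_depth (S : set (nat * nat)) : nat :=
  xget 0 [set d | peel S d = set0 /\ forall k, peel S k = set0 -> d <= k].

(* Exactly one partition satisfies the condition when S is finite and contained
   in the pairs of positive integers. *)
Definition lambda_set (S : set (nat * nat)) : set (nat * nat) :=
  xget set0 [set D | young D /\
    frobenius D = [seq corner (peel S k) | k <- iota 0 (peel_depth S)]].

(* w |-> lambda_weyl w is a bijection from W^{Lambda_0} onto the partitions. *)
Definition w_set {R : realType} (S : set (nat * nat)) : weight R -> weight R :=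
  xget (id : weight R -> weight R) [set w | weyl_min w /\ lambda_weyl w = lambda_set S].

(* Let i >= 1. The letters i and -i^v are both coded by i; with this coding
   the operators of index i on words in 1 < 2 < ... and those of index -i on
   words in -1^v < -2^v < ... coincide. None stands for the symbol 0. *)
Definition e_letter (i b : nat) : option nat :=
  if b == i.+1 then Some i else None.

Definition f_letter (i b : nat) : option nat :=
  if b == i then Some i.+1 else None.

Definition phi_letter (i b : nat) : nat := isSome (f_letter i b).

(* The largest k <= n such that e^k v is not 0. *)
Definition max_iter (e : seq nat -> option (seq nat)) (n : nat) (v : seq nat) :
  nat :=
  \max_(k < n.+1 | iter k (obind e) (Some v) != None) k.

(* The word b v is the tensor product of the letter b and the word v. The fuel
   n is the length of the word, which e preserves. *)
Fixpoint e_word_rec (i n : nat) (v : seq nat) : option (seq nat) :=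
  match n, v with
  | n'.+1, b :: v' =>
      if max_iter (e_word_rec i n') n' v' <= phi_letter i b
      then omap (cons^~ v') (e_letter i b)
      else omap (cons b) (e_word_rec i n' v')
  | _, _ => None
  end.

Definition e_word (i : nat) (v : seq nat) : option (seq nat) :=
  e_word_rec i (size v) v.

(* The maximum can be taken over k <= size v by [e_word_iter_size]. *)
Definition eps_word (i : nat) (v : seq nat) : nat :=
  max_iter (e_word i) (size v) v.

Fixpoint f_word (i : nat) (v : seq nat) : option (seq nat) :=
  if v is b :: v' then
    if eps_word i v' < phi_letter i b
    then omap (cons^~ v') (f_letter i b)
    else omap (cons b) (f_word i v')
  else None.

(* A matrix of finite support with entries in nat is the multiset in which
   (i, j) has multiplicity a_{-i^v,j}; indices start at 1. *)
Notation nmatrix := {mset (nat * nat)}%mset.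

Definition calM : set nmatrix :=
  [set A : nmatrix | forall p, A p != 0 -> 0 < p.1 /\ 0 < p.2].

Definition supp (A : nmatrix) : set (nat * nat) := [set p | A p != 0].

(* In -1^v < -2^v < ... the letters -i^v increase with i. *)
Definition le_ij (p q : nat * nat) : bool :=
  (p.2 < q.2) || (p.2 == q.2) && (q.1 <= p.1).

Definition le_kl (p q : nat * nat) : bool :=
  (p.1 < q.1) || (p.1 == q.1) && (q.2 <= p.2).

Definition word_ij (A : nmatrix) : seq (nat * nat) := sort le_ij (enum_mset A).

Definition word_kl (A : nmatrix) : seq (nat * nat) := sort le_kl (enum_mset A).

Definition f_mat (m : int) (A : nmatrix) : option nmatrix :=
  if m == 0%R then Some (msetD A (msetn 1 (1, 1)))
  else if (m < 0)%R then
    omap (fun v => seq_mset (zip v (unzip2 (word_ij A))))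
         (f_word `|m| (unzip1 (word_ij A)))
  else
    omap (fun v => seq_mset (zip (unzip1 (word_kl A)) v))
         (f_word `|m| (unzip2 (word_kl A))).

(* f_{i_1}^{m_1} ... f_{i_r}^{m_r} applied to the zero matrix; the list [s] is
   that of the pairs (i_k, m_k). *)
Definition f_string (s : seq (int * nat)) : option nmatrix :=
  foldr (fun im x => iter im.2 (obind (f_mat im.1)) x) (Some mset0) s.

Definition demazure (s : seq int) : set nmatrix :=
  [set A | exists2 m : seq nat, size m = size s & f_string (zip s m) = Some A].

Lemma root_indices_neq (i : int) : (root_indices i).1 != (root_indices i).2.
Proof.
have valK z : z != 0%R -> val (to_zx z) = z by move=> ?; rewrite /to_zx insubdK.
rewrite /root_indices; case: ltrgt0P => i0 /=; apply/eqP => /(congr1 val).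
- rewrite !valK ?gt_eqF// ?addr_gt0// => /eqP.
  by rewrite -subr_eq0 opprD addNKr oppr_eq0 oner_eq0.
- rewrite !valK ?lt_eqF// ?subr_lt0 ?(lt_trans i0)// => /eqP.
  by rewrite -subr_eq0 addrAC subrr add0r oppr_eq0 oner_eq0.
- by rewrite !valK.
Qed.

Lemma simple_refl_epsilon (R : realType) (i : int) (j : zx) :
  simple_refl i (epsilon j) =
  (epsilon (if j == (root_indices i).1 then (root_indices i).2
            else if j == (root_indices i).2 then (root_indices i).1 else j)
   : weight R).
Proof.
have := root_indices_neq i.
rewrite /simple_refl /pairing_h /simple_root; case: root_indices => p q /= pq.
apply/funext => k; rewrite /epsilon /=.
have [->|jp] := eqVneq j p.
  by rewrite [q == p]eq_sym (negbTE pq) subr0 mul1r opprB addrC subrK.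
have [->|jq] := eqVneq j q.
  by rewrite sub0r mulN1r opprK addrC subrK.
by rewrite subrr mul0r subr0.
Qed.

Lemma epsilon_inj (R : realType) : injective (@epsilon R).
Proof.
move=> j k /(congr1 (@^~ j)); rewrite /epsilon eqxx.
by case: eqP => // _ /eqP; rewrite oner_eq0.
Qed.

Lemma weyl_act_simple_refl (R : realType) (i : int) (j : zx) :
  weyl_act (@simple_refl R i) j =
  if j == (root_indices i).1 then (root_indices i).2
  else if j == (root_indices i).2 then (root_indices i).1 else j.
Proof.
rewrite /weyl_act; case: xgetP => [k _ /=|/(_ _ (simple_refl_epsilon R i j))//].
by rewrite simple_refl_epsilon => /epsilon_inj.
Qed.

Lemma e_word_cons (i b : nat) (v : seq nat) :
  e_word i (b :: v) =
  if eps_word i v <= phi_letter i b then omap (cons^~ v) (e_letter i b)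
  else omap (cons b) (e_word i v).
Proof.
have szE m v' : if e_word_rec i m v' is Some w then size w = size v' else True.
  elim: m v' => [|m IH] [|c v'] //=.
  case: ifP => _; first by rewrite /e_letter; case: eqP.
  by have := IH v'; case: e_word_rec => //= w ->.
have itE u k : iter k (obind (e_word_rec i (size u))) (Some u) =
      iter k (obind (e_word i)) (Some u) /\
    (if iter k (obind (e_word i)) (Some u) is Some u'
     then size u' = size u else True).
  elim: k => //= k [-> ]; case: (iter k _ _) => //= u' su'; rewrite -su'; split => //.
  by have := szE (size u') u'; rewrite /e_word; case: e_word_rec.
suff E u : max_iter (e_word_rec i (size u)) (size u) u = eps_word i u.
  by rewrite /e_word /= E.
by rewrite /eps_word /max_iter; apply: eq_bigl => k; case: (itE u k) => ->.
Qed.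

Lemma e_word_iter_size (i k : nat) (v : seq nat) :
  iter k (obind (e_word i)) (Some v) <> None -> k <= size v.
Proof.
have cE u : if e_word i u is Some w
            then (count_mem i.+1 w).+1 = count_mem i.+1 u else True.
  elim: u => [|c u IH] //=; rewrite e_word_cons; case: ifP => _.
    by rewrite /e_letter; case: eqP => //= _; rewrite ltn_eqF.
  by move: IH; case: e_word => //= w <-; rewrite addnS.
suff : if iter k (obind (e_word i)) (Some v) is Some w
       then count_mem i.+1 w + k = count_mem i.+1 v else True.
  case: (iter k _ _) => // w kE _; apply: leq_trans (count_size (pred1 i.+1) v).
  by rewrite -kE leq_addl.
elim: k => [|k] //=; first by rewrite addn0.
case: (iter k _ _) => //= w; have := cE w; case: e_word => //= w' <-.
by rewrite addSnnS.
Qed.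

(* Main.v *)
(* Say that a point of a set S starts a chain of length k when S contains k
   points, the first being that one, that increase strictly in both coordinates.
   The points left after peeling k border strips off S are those that start a
   chain of length k + 1, so the number of boxes of lambda(S) of content c is the
   maximal length of a chain that starts in a column > c (if c >= 0) or in a row
   > -c (if c <= 0). The operators f_i and e_i preserve all these numbers except
   the one with c = i; if e_i kills A, i > 0, a chain starting in column i + 1 can
   be extended on the left by an entry of column i (for i < 0, rows play this
   role). Hence, when a partition is enlarged by a box of content i, the set of
   the A with lambda(supp A) inside it is replaced by its closure under f_i.
   On the other side, Z^x is identified with Z in such a way that every s_i is
   the transposition of i - 1 and i, and an element of W^{Lambda_0} becomes the
   permutation whose values on negative and on nonnegative integers are read off
   the rows and the columns of its partition; removing the first letter s_i of a
   reduced expression removes a box of content i. The length and the Bruhat order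
   are controlled by the exchange condition alone. *)

Require Import Defs.
From Stdlib Require Import Relation_Operators.
From mathcomp Require Import all_boot all_order all_algebra finmap multiset.
From mathcomp Require Import boolp classical_sets functions cardinality reals.
From mathcomp Require Import complex zify.

Set Implicit Arguments.
Unset Strict Implicit.
Unset Printing Implicit Defensive.

Import Order.TTheory GRing.Theory Num.Theory.

Local Open Scope classical_set_scope.
Local Open Scope nat_scope.

(** * The signature rule *)

(** Counts the letters i + 1 that stay unmatched when each i cancels one i + 1 on its right, if any;
    the tensor product rule makes this number epsilon_i. *)
Fixpoint eps_rec (i : nat) (v : seq nat) : nat :=
  if v is b :: v' then (eps_rec i v' - (b == i)) + (b == i.+1) else 0.

(** [e_word] on a word b v consults [eps_word] of v, which in turn counts applications of [e_word].
    So [key] derives the first half for one length from the second half for that length, and the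
    second half goes by induction on the length. *)
Lemma e_word_eps (i : nat) (v : seq nat) :
  eps_word i v = eps_rec i v /\
  if e_word i v is Some w then eps_rec i v = (eps_rec i w).+1
  else eps_rec i v = 0.
Proof.
have key u : (forall w, size w = size u ->
    if e_word i w is Some w' then eps_rec i w = (eps_rec i w').+1
    else eps_rec i w = 0) -> eps_word i u = eps_rec i u.
  move=> H.
  have it k : if iter k (obind (e_word i)) (Some u) is Some w
    then size w = size u /\ eps_rec i u = eps_rec i w + k
    else eps_rec i u < k.
    elim: k => [|k]; first by rewrite /= addn0.
    rewrite iterS; case: (iter k _ _) => [w [sw ew]|/ltnW//].
    have := H _ sw; rewrite /obind /oapp.
    have: if e_word i w is Some w' then size w' = size w else True.
      elim: (w) => [|c x IH] //=; rewrite e_word_cons; case: ifP => _.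
        by rewrite /e_letter; case: eqP.
      by move: IH; case: e_word => //= ? ->.
    case: (e_word i w) => [w' sw' e'|_ e']; last by lia.
    by rewrite sw' sw; split => //; lia.
  have le_size : eps_rec i u <= size u.
    by elim: (u) => //= c x; lia.
  rewrite /eps_word /max_iter; apply/eqP; rewrite eqn_leq; apply/andP; split.
    apply/bigmax_leqP => k; have := it k; case: (iter _ _ _) => // w [_ ->] _.
    exact: leq_addl.
  have ltu : eps_rec i u < (size u).+1 by [].
  apply: (@leq_bigmax_cond _ _ (fun k : 'I_(size u).+1 => k : nat)
    (Ordinal ltu)) => /=.
  by have := it (eps_rec i u); case: (iter _ _ _) => //; rewrite ltnn.
suff H n u : size u = n ->
    if e_word i u is Some w then eps_rec i u = (eps_rec i w).+1
    else eps_rec i u = 0.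
  by split; [apply: key => w _|]; exact: H.
elim: n u => [|n IH] [|b u] //= [su].
rewrite e_word_cons key; last by move=> w ws; apply: IH; rewrite ws.
rewrite /phi_letter /f_letter /e_letter.
have := IH _ su; case: (eqVneq b i) => [->|bi] /=.
  rewrite (ltn_eqF (ltnSn i)); case: leqP => /= [|ltu]; first by lia.
  by case: e_word => [w|] /=; rewrite ?eqxx ?(ltn_eqF (ltnSn i)); lia.
case: leqP => /= [|ltu].
  rewrite leqn0 => /eqP e0 _; case: (b == i.+1) => /=; rewrite e0 // eqxx.
  by rewrite (ltn_eqF (ltnSn i)).
by case: (e_word i u) => [w|] /=; rewrite ?(negbTE bi); lia.
Qed.

Lemma eps_wordE (i : nat) (v : seq nat) : eps_word i v = eps_rec i v.
Proof. by case: (e_word_eps i v). Qed.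

Lemma eps_rec_cat0 (i : nat) (u v : seq nat) :
  eps_rec i v = 0 -> i.+1 \notin u -> eps_rec i (u ++ v) = 0.
Proof.
move=> ev; elim: u => //= b u IH; rewrite inE negb_or eq_sym => /andP[/negbTE ->].
by move/IH ->.
Qed.

Lemma eps_rec_eq0 (i : nat) (u v : seq nat) :
  eps_rec i (u ++ i.+1 :: v) = 0 -> i \in u.
Proof.
elim: u => [|b u IH] /=; first by rewrite eqxx; lia.
by rewrite inE eq_sym; case: (eqVneq b i) => //= _ ?; apply: IH; lia.
Qed.

(** The letter changed is the leftmost unmatched i: no i + 1 of y is unmatched, and every i of x is
    cancelled inside x. *)
Lemma f_wordP (i : nat) (v w : seq nat) : f_word i v = Some w ->
  exists x y, [/\ v = x ++ i :: y, w = x ++ i.+1 :: y, eps_rec i y = 0 &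
    forall x1 x2, x = x1 ++ i :: x2 -> i.+1 \in x2].
Proof.
elim: v w => //= b v IH w; rewrite eps_wordE /phi_letter /f_letter.
case: (eqVneq b i) => [->|bi] /=.
  case: ltnP => [|ev].
    rewrite ltnS leqn0 => /eqP ev [<-]; exists [::], v; split => //.
    by case.
  case E: f_word => //= -[<-]; have [x [y [vE -> ey Hx]]] := IH _ E.
  exists (i :: x), y; split => //=; first by rewrite vE.
  case=> [|c x1] x2 /= []; [|move=> _ xE]; last exact: (Hx x1).
  move=> <-; apply: contraTT ev => ix; rewrite vE -ltnNge.
  rewrite eps_rec_cat0 //= eqxx (ltn_eqF (ltnSn i)); lia.
case E: f_word => //= -[<-].
have [x [y [vE -> ey Hx]]] := IH _ E.
exists (b :: x), y; split => //=; first by rewrite vE.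
by case=> [|c x1] x2 /= [bE xE]; [rewrite bE eqxx in bi | exact: (Hx x1)].
Qed.

Lemma e_wordP (i : nat) (v w : seq nat) : e_word i v = Some w ->
  exists x y, [/\ v = x ++ i.+1 :: y, w = x ++ i :: y, eps_rec i y = 0 &
    f_word i w = Some v].
Proof.
elim: v w => // b v IH w; rewrite e_word_cons eps_wordE.
rewrite /phi_letter /f_letter /e_letter.
case: (eqVneq b i) => [->|bi] /=.
  rewrite (ltn_eqF (ltnSn i)); case: ifP => //; rewrite leqNgt => /negbFE ev.
  case E: e_word => [u|] //= -[<-]; have [x [y [-> uE ey fE]]] := IH _ E.
  exists (i :: x), y; split; rewrite ?uE //=.
  rewrite -uE eps_wordE /phi_letter /f_letter eqxx /= fE.
  by have := (e_word_eps i v).2; rewrite E => evE; rewrite ifF //; lia.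
case: ifP => [|ev].
  rewrite leqn0 => /eqP ev; case: eqP => //= -> [<-].
  by exists [::], v; rewrite /= eps_wordE ev /phi_letter /f_letter eqxx.
case E: e_word => [u|] //= -[<-]; have [x [y [-> uE ey fE]]] := IH _ E.
exists (b :: x), y; split; rewrite ?uE //=.
by rewrite -uE /phi_letter /f_letter (negbTE bi) /= fE.
Qed.

(** * Chains and partitions *)

Definition swap_set (S : set (nat * nat)) : set (nat * nat) :=
  [set p | S (p.2, p.1)].

Lemma swap_setK : involutive swap_set.
Proof. by move=> S; apply/seteqP; split=> -[]. Qed.

(* [chain S k p]: p is the first of k + 1 points of S that increase strictly in
   both coordinates. *)
Fixpoint chain (S : set (nat * nat)) (k : nat) (p : nat * nat) : Prop :=
  if k is k'.+1 then
    S p /\ exists2 q, chain S k' q & p.1 < q.1 /\ p.2 < q.2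
  else S p.

Lemma chain_sub (S : set (nat * nat)) k p : chain S k p -> S p.
Proof. by case: k => [|k] //= []. Qed.

Lemma chainS (S : set (nat * nat)) k p : chain S k.+1 p -> chain S k p.
Proof.
elim: k p => [|k IH] p /=; first by case.
by move=> [Sp [q /IH qk pq]]; split=> //; exists q.
Qed.

Lemma chain_mono (S T : set (nat * nat)) k p :
  S `<=` T -> chain S k p -> chain T k p.
Proof.
move=> ST; elim: k p => [|k IH] p /=; first exact: ST.
by move=> [/ST Tp [q /IH qk pq]]; split=> //; exists q.
Qed.

Lemma chain_swap (S : set (nat * nat)) k p :
  chain (swap_set S) k p <-> chain S k (p.2, p.1).
Proof.
elim: k p => [|k IH] p //=; split => -[Sp [q qk [pq1 pq2]]]; split=> //.
  by exists (q.2, q.1) => //; apply/IH.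
by exists (q.2, q.1) => //; apply/IH; case: (q) qk.
Qed.

(* The supports of a matrix and of its image under f_i, i > 0, where one pair
   (k, i) becomes (k, i + 1); the last two clauses say that every i on its left
   and every i + 1 on its right is cancelled in the signature rule. *)
Definition raises (i k : nat) (S T : set (nat * nat)) : Prop :=
  [/\ S (k, i), T (k, i.+1),
      (forall p, S p -> p = (k, i) \/ T p) /\
      (forall p, T p -> p = (k, i.+1) \/ S p),
      forall k', S (k', i.+1) -> k < k' ->
        exists2 l, k <= l < k' & T (l, i) &
      forall k', S (k', i) -> k' < k ->
        exists2 l, k' < l <= k & S (l, i.+1)].

(** Only the point (k, i) can be lost. If the next point lies beyond column i + 1, (k, i + 1)
    replaces it; otherwise that point is in column i + 1 and cancellation supplies some (l, i) of T
    before it. *)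
Lemma raises_chain_fwd i k S T n p : raises i k S T -> chain S n p ->
  exists2 p', chain T n p' & p.1 <= p'.1 /\ p.2 <= p'.2.
Proof.
case=> [Ski Tki1 [ST _] HV _]; elim: n p => [|n IH] p /=.
  by move=> /ST[->|Tp]; [exists (k, i.+1) => //=; lia | exists p].
move=> [Sp [q qn [pq1 pq2]]]; have [q' q'n [qq1 qq2]] := IH _ qn.
have [pE|Tp] := ST _ Sp; last first.
  by exists p => //; split=> //; exists q' => //; lia.
move: pq1 pq2; rewrite pE /= => kq iq.
have [qi|qi] := leqP q.2 i.+1; last first.
  by exists (k, i.+1) => /=; [split=> //; exists q' => //=|]; lia.
have qE : q = (q.1, i.+1) by case: (q) iq qi => x y /= *; congr pair; lia.
have [|l kl Tl] := HV q.1 _ kq; first by rewrite -qE; exact: chain_sub qn.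
by exists (l, i) => /=; [split=> //; exists q' => //=|]; lia.
Qed.

(** Only (k, i + 1) can be missing from S. After a point of column < i it is replaced by (k, i),
    after a point of column i by the (l, i + 1) that cancels this point. Only as a first point does
    it shift the start of the chain, to (k, i). *)
Lemma raises_chain_bwd i k S T n p : raises i k S T -> chain T n p ->
  exists2 p', chain S n p' &
    p'.1 = p.1 /\ (p'.2 = p.2 \/ p.2 = i.+1 /\ p'.2 = i).
Proof.
case=> [Ski Tki1 [_ TS] _ HU].
(* The induction is strong because the claim is applied to the point that follows a replaced one. *)
have main m q : S q -> chain T m q -> chain S m q.
  elim/ltn_ind: m q => -[|m] IH q Sq //= [Tq [r rm [qr1 qr2]]].
  split=> //; have [rE|Sr] := TS _ (chain_sub rm); last first.
    by exists r => //; exact: IH.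
  case: m IH rm => [|m] IH /= rm.
    move: qr1 qr2; rewrite rE /= => qk; rewrite ltnS leq_eqVlt => /orP[/eqP qi|].
      have [|l kl Sl] := HU q.1 _ qk; first by rewrite -qi -surjective_pairing.
      by exists (l, i.+1) => //=; lia.
    by move=> qi; exists (k, i).
  case: rm => Tr [t tm [rt1 rt2]].
  have St : chain S m t.
    apply: IH => //; have [tE|//] := TS _ (chain_sub tm).
    by move: rt1; rewrite rE tE ltnn.
  move: qr1 qr2 rt1 rt2; rewrite rE /= => qk + kt it.
  rewrite ltnS leq_eqVlt => /orP[/eqP qi|qi].
    have [|l kl Sl] := HU q.1 _ qk; first by rewrite -qi -surjective_pairing.
    by exists (l, i.+1) => /=; [split=> //; exists t => //=|]; lia.
  by exists (k, i) => //=; split=> //; exists t => //=; lia.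
move=> pn; have [pE|Sp] := TS _ (chain_sub pn); last first.
  by exists p; [exact: main | split=> //; left].
case: n pn => [|n] /=; first by exists (k, i) => //; rewrite pE; split; [|right].
move=> [Tp [q qn [pq1 pq2]]]; exists (k, i); last by rewrite pE; split; [|right].
split=> //; exists q; last by move: pq1 pq2; rewrite pE /=; lia.
apply: main => //; have [qE|//] := TS _ (chain_sub qn).
by move: pq1; rewrite qE pE ltnn.
Qed.

(* [conj_part r c]: r and c are the row and column lengths of a partition, both
   indexed from 0. *)
Definition conj_part (r c : nat -> nat) : Prop :=
  forall i j, (j < r i) = (i < c j).

(** Below the diagonal length, c k - k and r k - k are the Frobenius coordinates of index k + 1;
    these bounds thus express that lambda(S) is contained in the partition ([lambda_set_fits]). *)
Definition fits (r c : nat -> nat) (S : set (nat * nat)) : Prop :=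
  (forall p, S p -> 0 < p.1 /\ 0 < p.2) /\
  forall k p, chain S k p -> p.1 + k <= c k /\ p.2 + k <= r k.

Definition incr (a : nat) (r : nat -> nat) (i : nat) : nat := r i + (i == a).

Lemma conj_part_sym r c : conj_part r c -> conj_part c r.
Proof. by move=> rc i j; rewrite rc. Qed.

Lemma conj_part_noninc r c i j : conj_part r c -> i <= j -> r j <= r i.
Proof.
move=> rc ij; rewrite leqNgt; apply/negP => rij.
have : r i < r j by [].
rewrite rc => ji; have : i < c (r i) by lia.
by rewrite -rc ltnn.
Qed.

Lemma fits_swap r c S : fits r c S -> fits c r (swap_set S).
Proof.
move=> [Spos Sr]; split=> [p /Spos[]//|k p /chain_swap /Sr[]//].
Qed.

Lemma fits_incr r c a b S : fits r c S -> fits (incr a r) (incr b c) S.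
Proof.
move=> [Spos Sr]; split=> // k p /Sr[H1 H2].
by rewrite /incr; split; apply: leq_trans (leq_addr _ _).
Qed.

Lemma fits_lowers r c i k S T : 0 < i -> raises i k S T ->
  fits r c T -> fits r c S.
Proof.
move=> i0 ST [Tpos Tr]; split=> [p|n p].
  case: ST => _ Tki [ST _] _ _ /ST[->/=|/Tpos//].
  by have [] := Tpos _ Tki.
by case/(raises_chain_fwd ST) => p' /Tr[H1 H2] [H3 H4]; lia.
Qed.

(** * Adding one box to a partition *)

Section AddBox.
Variables (r c : nat -> nat) (a b : nat).
Hypotheses (rc : conj_part r c) (ra : r a = b) (cb : c b = a).
Local Notation r' := (incr a r).
Local Notation c' := (incr b c).

Lemma conj_part_incr : conj_part r' c'.
Proof.
move=> i j; rewrite /incr; have := rc i j.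
have := rc a j; have := rc i b; rewrite ra cb.
case: (eqVneq i a) => [->|ia]; case: (eqVneq j b) => [->|jb]; rewrite ?ra ?cb; lia.
Qed.

(** A bound could fail only for a chain whose start moved from column i to i + 1, and only if r' n =
    n + i. No row has this length: r' n - n is > i for n <= a and < i for n > a. *)
Lemma fits_raises i k S T : b = a + i -> 0 < i -> raises i k S T ->
  fits r' c' S -> fits r' c' T.
Proof.
move=> bE i0 ST [Spos Sr]; split=> [p|n p pn].
  by case: ST => Ski _ [_ TS] _ _ /TS[->/=|/Spos//]; have [] := Spos _ Ski.
have [p' p'n [p1 p2]] := raises_chain_bwd ST pn.
have [] := Sr _ _ p'n; rewrite p1 => Hc Hr; split=> //.
case: p2 Hr => [->//|[-> ->]] Hr; rewrite addSn ltn_neqAle Hr andbT.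
apply/eqP => E.
have [na|na|na] := ltngtP n a.
- have := conj_part_noninc conj_part_incr (ltnW na); rewrite -E /incr eqxx ra; lia.
- have := conj_part_noninc rc (ltnW na); move: E.
  by rewrite /incr gtn_eqF // ra; lia.
- by move: E; rewrite na /incr eqxx ra; lia.
Qed.

(* A new longest chain could only start in column i + 1; as e_i kills the
   matrix, it could be extended on the left by a pair in column i. *)
Lemma fits_highest i S : b = a + i -> 0 < i ->
  (forall k, S (k, i.+1) -> exists2 l, l < k & S (l, i)) ->
  fits r' c' S -> fits r c S.
Proof.
move=> bE i0 HS [Spos Sr]; split=> // k p pk; have [Hc Hr] := Sr _ _ pk.
have [p1 p2] := Spos _ (chain_sub pk).
split.
  move: Hc; rewrite /incr; case: eqP => [kb|_]; last by rewrite addn0.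
  by move: p1; rewrite kb cb; lia.
move: Hr; rewrite /incr; case: eqP => [ka|_]; last by rewrite addn0.
rewrite ka ra => Hr; have [//|] := leqP (p.2 + a) b => pi.
have pE : p = (p.1, i.+1) by case: (p) Hr pi => x y /= ? ?; congr pair; lia.
have [|l lp Sl] := HS p.1; first by rewrite -pE; exact: chain_sub pk.
have /Sr[_ /=] : chain S k.+1 (l, i).
  by split=> //; exists p => //=; rewrite pE /=; lia.
rewrite ka /incr gtn_eqF // addn0.
have := conj_part_noninc rc (leqnSn a); rewrite ra; lia.
Qed.

(** Coordinates being positive, (1, 1) can only be the first point of a chain. If k + 1 points
    follow it, their bounds force k < a, and the new box (a, a) then gives the bounds for the whole
    chain. *)
Lemma fits_add11 S T : a = b -> T `<=` S `|` [set (1, 1)] ->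
  fits r' c' S -> fits r' c' T.
Proof.
move=> ab TS [Spos Sr]; split=> [p /TS[/Spos//|->//]|k p].
have main (q : nat * nat) m : q != (1, 1) -> 0 < q.1 -> 0 < q.2 ->
    chain T m q -> chain S m q.
  elim: m q => [|m IH] q q1 q01 q02 /=.
    by case/TS => // qE; rewrite qE eqxx in q1.
  move=> [/TS[Sq|qE]]; last by rewrite qE eqxx in q1.
  move=> [t tm [t1 t2]]; split=> //; exists t => //; apply: IH => //; try lia.
  by apply/eqP => tE; move: t1; rewrite tE /=; lia.
have Tpos q : T q -> 0 < q.1 /\ 0 < q.2 by case/TS => [/Spos//|->].
case: (eqVneq p (1, 1)) => [-> /=|p1 pk]; last first.
  by apply: Sr; apply: main => //; have [] := Tpos _ (chain_sub pk).
case: k => [_|k [_ [q qk [/= q1 q2]]]].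
  rewrite /incr; have := conj_part_noninc rc (leq0n a).
  have := conj_part_noninc (conj_part_sym rc) (leq0n b).
  by rewrite ra cb ab; case: eqP => [<-|/eqP]; lia.
have /Sr[] : chain S k q.
  apply: main => //; try lia.
  by apply/eqP => qE; move: q1; rewrite qE.
have [kb|kb] := ltnP k b; last first.
  have := conj_part_noninc conj_part_incr (_ : a <= k); rewrite /incr eqxx ra; lia.
have := conj_part_noninc conj_part_incr (_ : k.+1 <= a).
have := conj_part_noninc (conj_part_sym conj_part_incr) (_ : k.+1 <= b).
rewrite /incr !eqxx ra cb; lia.
Qed.

(** The bounds differ only for k = a, where the larger partition allows no starting point but (1,
    1). *)
Lemma fits_remove11 S : a = b -> ~ S (1, 1) -> fits r' c' S -> fits r c S.
Proof.
move=> ab S11 [Spos Sr]; split=> // k p pk; have := Sr _ _ pk.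
have [p1 p2] := Spos _ (chain_sub pk).
rewrite /incr -ab; case: (eqVneq k a) => [->|]; last by rewrite !addn0.
rewrite {2}ab ra cb => -[H1 H2]; case: S11.
have -> : (1, 1) = p; last exact: chain_sub pk.
by case: (p) p1 p2 H1 H2 => x y /= *; congr pair; lia.
Qed.

End AddBox.

(** * The operators on matrices *)

Definition swap_pair (p : nat * nat) : nat * nat := (p.2, p.1).

Lemma le_kl_trans : transitive le_kl.
Proof. by move=> [a b] [c d] [e f]; rewrite /le_kl /=; lia. Qed.

Lemma le_kl_total : total le_kl.
Proof. by move=> [a b] [c d]; rewrite /le_kl /=; lia. Qed.

Lemma le_kl_anti : antisymmetric le_kl.
Proof. by move=> [a b] [c d]; rewrite /le_kl /= => H; congr pair; lia. Qed.

Lemma sorted_pairwise_kl L : sorted le_kl L = pairwise le_kl L.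
Proof. exact: sorted_pairwise le_kl_trans L. Qed.

(* The operator f_i on matrices in terms of their sorted lists of pairs. *)
Definition f_pairs (i : nat) (L : seq (nat * nat)) : option (seq (nat * nat)) :=
  omap (zip (unzip1 L)) (f_word i (unzip2 L)).

Lemma unzip2_split (L : seq (nat * nat)) x b y : unzip2 L = x ++ b :: y ->
  exists U k V, [/\ L = U ++ (k, b) :: V, unzip2 U = x & unzip2 V = y].
Proof.
elim: L x => [|[k l] L IH] [|c x] //= [-> LE].
  by exists [::], k, L.
have [U [k' [V [-> <- <-]]]] := IH _ LE.
by exists ((k, c) :: U), k', V.
Qed.

Lemma zip_unzip_replace (U V : seq (nat * nat)) p b :
  zip (unzip1 (U ++ p :: V)) (unzip2 U ++ b :: unzip2 V) = U ++ (p.1, b) :: V.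
Proof.
by rewrite /unzip1 map_cat zip_cat ?size_map //= !zip_unzip.
Qed.

(** Every i + 1 is cancelled by an i on its left. Pairs of one row are listed by decreasing columns,
    so a pair (l, i) listed before (k, i + 1) has l < k. *)
Lemma eps0_before i (V : seq (nat * nat)) (k : nat) : pairwise le_kl V ->
  eps_rec i (unzip2 V) = 0 -> (k, i.+1) \in V ->
  exists2 l, l < k & (l, i) \in V.
Proof.
move=> sV eV kV; case/splitPr: kV sV eV => V1 V2; rewrite pairwise_cat.
move=> /andP[/allrelP le12 _]; rewrite /unzip2 map_cat => /eps_rec_eq0.
case/mapP => -[l i'] lV /= iE; rewrite -{}iE in lV.
exists l; last by rewrite mem_cat lV.
by have := le12 _ _ lV (mem_head _ _); rewrite /le_kl /=; lia.
Qed.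

Lemma matched_after i (U : seq (nat * nat)) (k : nat) : pairwise le_kl U ->
  (forall x1 x2, unzip2 U = x1 ++ i :: x2 -> i.+1 \in x2) -> (k, i) \in U ->
  exists2 l, k < l & (l, i.+1) \in U.
Proof.
move=> sU HU kU; case/splitPr: kU sU HU => U1 U2; rewrite pairwise_cat /=.
move=> /and3P[_ _ /andP[/allP le2 _]] /(_ (unzip2 U1) (unzip2 U2)).
rewrite /unzip2 map_cat => /(_ erefl) /mapP[[l i'] lU /= iE].
exists l; last by rewrite mem_cat inE iE lU !orbT.
by have := le2 _ lU; rewrite -iE /le_kl /=; lia.
Qed.

Lemma f_pairs_raises i L L' : sorted le_kl L -> f_pairs i L = Some L' ->
  sorted le_kl L' /\
  exists k, raises i k [set p | p \in L] [set p | p \in L'].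
Proof.
rewrite !sorted_pairwise_kl /f_pairs; case E: f_word => [w|] //= sL [<-].
have [x [y [LE -> ey Hx]]] := f_wordP E.
have {LE} [U [k [V [LE Ux Vy]]]] := unzip2_split LE.
rewrite -{}Ux -{}Vy in Hx ey *; rewrite {}LE {L E} in sL *.
rewrite zip_unzip_replace /=.
move: sL; rewrite !pairwise_cat /= => /and3P[/allrelP UkV sU /andP[/allP kV sV]].
have Uk u : u \in U -> le_kl u (k, i) by move=> uU; apply: UkV; rewrite ?mem_head.
(* This keeps the new list sorted. An earlier pair (k, i) would be cancelled inside U by some (l, i
   + 1) with l > k, which cannot precede (k, i). *)
have Ukn : (k, i) \notin U.
  apply/negP => /(matched_after sU Hx)[l kl /Uk]; rewrite /le_kl /=; lia.
split.
  rewrite sU sV andbT /=; apply/andP; split.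
    apply/allrelP => u v uU; rewrite inE => /predU1P[->|vV]; last first.
      by apply: UkV; rewrite // inE vV orbT.
    have := Uk _ uU; case: u uU => u1 u2 uU; rewrite /le_kl /=.
    case: (ltngtP u1 k) => //= uk; rewrite leq_eqVlt => /orP[/eqP iE|//].
    by rewrite iE -uk uU in Ukn.
  by apply/allP => v /kV; rewrite /le_kl /=; lia.
exists k; split=> //=.
- by rewrite mem_cat mem_head orbT.
- by rewrite mem_cat mem_head orbT.
- split=> p; rewrite /= !mem_cat !inE.
    by case/or3P => [->|/eqP ->|->]; rewrite ?orbT; [right|left|right].
  by case/or3P => [->|/eqP ->|->]; rewrite ?orbT; [right|left|right].
- move=> k'; rewrite mem_cat inE => /or3P[/Uk|/eqP[_]|k'V] kk'.
  + by move: kk'; rewrite /le_kl /=; lia.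
  + by lia.
  + have [l lk lV] := eps0_before sV ey k'V.
    exists l; last by rewrite mem_cat inE lV !orbT.
    by have := kV _ lV; rewrite /le_kl /=; lia.
- move=> k'; rewrite mem_cat inE => /or3P[k'U|/eqP[->]|/kV] kk'.
  + have [l lk lU] := matched_after sU Hx k'U.
    exists l; last by rewrite mem_cat lU.
    by have := Uk _ lU; rewrite /le_kl /=; lia.
  + by rewrite ltnn in kk'.
  + by move: kk'; rewrite /le_kl /=; lia.
Qed.

(** Apply e_i until no i + 1 is unmatched; f_i undoes each step. *)
Lemma f_pairs_highest i L : sorted le_kl L -> exists n L0,
  [/\ sorted le_kl L0, eps_rec i (unzip2 L0) = 0 &
      iter n (obind (f_pairs i)) (Some L0) = Some L].
Proof.
elim: {L}(eps_rec i (unzip2 L)) {-2}L (erefl (eps_rec i (unzip2 L)))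
  => [|n IH] L en sL; first by exists 0, L.
have := (e_word_eps i (unzip2 L)).2; case E: e_word => [w|]; rewrite en // => -[ew].
have [x [y [LE wE ey fE]]] := e_wordP E.
have {LE} [U [k [V [LE Ux Vy]]]] := unzip2_split LE.
have L0E : zip (unzip1 L) w = U ++ (k, i) :: V.
  by rewrite wE -Ux -Vy LE zip_unzip_replace.
have w2 : unzip2 (zip (unzip1 L) w) = w.
  by rewrite L0E wE /unzip2 map_cat /= -/unzip2 -Ux -Vy.
have w1 : unzip1 (zip (unzip1 L) w) = unzip1 L.
  by rewrite L0E LE /unzip1 !map_cat.
have [||m [L0 [sL0 eL0 L0m]]] := IH (zip (unzip1 L) w); first by rewrite w2.
  rewrite L0E; move: sL; rewrite LE !sorted_pairwise_kl !pairwise_cat /=.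
  move=> /and3P[/allrelP UkV -> /andP[/allP kV sV]]; rewrite sV andbT /=.
  apply/andP; split.
    apply/allrelP => u v uU; rewrite inE => /predU1P[->|vV]; last first.
      by apply: UkV; rewrite // inE vV orbT.
    by have := UkV _ _ uU (mem_head _ _); rewrite /le_kl /=; lia.
  (* Sortedness could fail only through a later pair (k, i + 1); it would be cancelled inside V by
     some (l, i) with l < k, against the order. *)
  apply/allP => -[v1 v2] vV; have := kV _ vV; rewrite /le_kl /=.
  case: (ltngtP k v1) => //= kv; rewrite leq_eqVlt => /orP[/eqP vi|//].
  rewrite -Vy in ey; rewrite vi -kv in vV.
  have [l lk lV] := eps0_before sV ey vV.
  by have := kV _ lV; rewrite /le_kl /=; lia.
exists m.+1, L0; split=> //; rewrite iterS L0m /= /f_pairs w2 w1 fE /=.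
by rewrite zip_unzip.
Qed.

(** Transposing the pairs for negative indices lets the single order [le_kl] and the single operator
    [f_pairs] serve both signs. *)
Definition of_pairs (neg : bool) (L : seq (nat * nat)) : nmatrix :=
  seq_mset (if neg then map swap_pair L else L).

Lemma of_pairs_surj neg A : exists2 L, sorted le_kl L & A = of_pairs neg L.
Proof.
case: neg; [exists (map swap_pair (word_ij A)) | exists (word_kl A)].
- by rewrite sorted_map; apply: sort_sorted => p q; apply: le_kl_total.
- rewrite /of_pairs -map_comp (@eq_map _ _ _ id) ?map_id; last by case.
  rewrite -[LHS]seq_mset_id; apply/eq_seq_msetP.
  by rewrite perm_sym /word_ij perm_sort.
- exact: sort_sorted le_kl_total _.
- rewrite -[LHS]seq_mset_id; apply/eq_seq_msetP.
  by rewrite perm_sym /word_kl perm_sort.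
Qed.

Lemma word_klE L : sorted le_kl L -> word_kl (seq_mset L) = L.
Proof.
move=> sL; apply: (sorted_eq le_kl_trans le_kl_anti) => //.
  exact: sort_sorted le_kl_total _.
by rewrite perm_sort perm_eq_seq_mset.
Qed.

Lemma word_ijE L : sorted le_kl L ->
  word_ij (seq_mset (map swap_pair L)) = map swap_pair L.
Proof.
move=> sL; apply: (@sorted_eq _ le_ij).
- by move=> [a b] [c d] [e f]; rewrite /le_ij /=; lia.
- by move=> [a b] [c d]; rewrite /le_ij /= => H; congr pair; lia.
- by apply: sort_sorted => -[a b] [c d]; rewrite /le_ij /=; lia.
- by rewrite sorted_map; apply: sub_sorted sL => -[a b] [c d].
- by rewrite perm_sort perm_eq_seq_mset.
Qed.

Lemma zip_swap (v : seq nat) (L : seq (nat * nat)) :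
  zip v (unzip2 (map swap_pair L)) = map swap_pair (zip (unzip1 L) v).
Proof. by elim: L v => [|p L IH] [|b v] //=; rewrite IH. Qed.

Lemma f_mat_of_pairs (m : int) L : m != 0%R -> sorted le_kl L ->
  f_mat m (of_pairs (m < 0)%R L) = omap (of_pairs (m < 0)%R) (f_pairs `|m| L).
Proof.
move=> m0 sL; rewrite /f_mat (negbTE m0) /of_pairs /f_pairs.
case: (m < 0)%R; last by rewrite word_klE //; case: (f_word _ _).
rewrite word_ijE //.
have -> : unzip1 (map swap_pair L) = unzip2 L by rewrite /unzip1 -map_comp.
by case: (f_word _ _) => //= v; rewrite zip_swap.
Qed.

Lemma supp_of_pairs neg L : supp (of_pairs neg L) =
  if neg then swap_set [set p | p \in L] else [set p | p \in L].
Proof.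
apply/seteqP; rewrite /supp /of_pairs; case: neg; split=> -[x y] /=;
  rewrite mset_seqE -lt0n -has_count has_pred1 //.
- by case/mapP => -[z t] zL [-> ->].
- by move=> yxL; apply/mapP; exists (y, x).
Qed.

(** * One step of the Demazure construction *)

Definition f_closure (m : int) (X : set nmatrix) : set nmatrix :=
  [set A | exists n B, X B /\ iter n (obind (f_mat m)) (Some B) = Some A].

Lemma demazure_cons m s : demazure (m :: s) = f_closure m (demazure s).
Proof.
apply/seteqP; split=> A /=.
  case=> -[|n ns] //= [ss]; case E: (f_string _) => [B|] it; last first.
    have : iter n (obind (f_mat m)) None = None by elim: n {it} => //= k ->.
    by rewrite it.
  by exists n, B; split=> //; exists ns.
by move=> [n [B [[ns sn E] it]]]; exists (n :: ns) => /=; rewrite ?sn ?E.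
Qed.

Lemma demazure_nil : demazure [::] = [set mset0].
Proof.
by apply/seteqP; split=> A /=; [case=> -[|//] _ [] | move=> ->; exists [::]].
Qed.

Section DemazureStep.
Variables (r c : nat -> nat) (a b : nat).
Hypotheses (rc : conj_part r c) (ra : r a = b) (cb : c b = a).
Local Notation r' := (incr a r).
Local Notation c' := (incr b c).

Lemma f_pairs_fits i L L' : b = a + i -> 0 < i -> sorted le_kl L ->
  f_pairs i L = Some L' -> fits r' c' [set p | p \in L] ->
  fits r' c' [set p | p \in L'].
Proof.
move=> bE i0 sL /(f_pairs_raises sL)[_ [k LL']].
exact: (fits_raises rc ra cb bE i0 LL').
Qed.

(** Descending from L to its highest element keeps the bounds of the enlarged partition; at the
    bottom [fits_highest] improves them to those of the smaller one. *)
Lemma fits_f_pairs i L : b = a + i -> 0 < i -> sorted le_kl L ->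
  fits r' c' [set p | p \in L] -> exists n L0, [/\ sorted le_kl L0,
    fits r c [set p | p \in L0] &
    iter n (obind (f_pairs i)) (Some L0) = Some L].
Proof.
move=> bE i0 sL Lr; have [n [L0 [sL0 eL0 L0n]]] := f_pairs_highest i sL.
exists n, L0; split=> //; apply: (fits_highest rc ra cb bE i0).
  move=> k /eps0_before H; apply: H => //.
  by rewrite -sorted_pairwise_kl.
elim: n L sL Lr L0n => [|n IH] L sL Lr /=; first by case=> ->.
case E: (iter n _ _) => [L1|] //= fL1.
have sL1 : sorted le_kl L1.
  elim: n {IH} L1 E {fL1} => [|n IH] L1 /=; first by case=> <-.
  by case E: (iter n _ _) => [L2|] //= /(f_pairs_raises (IH _ E))[].
apply: (IH L1) => //; have [_ [k LL1]] := f_pairs_raises sL1 fL1.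
exact: fits_lowers i0 LL1 Lr.
Qed.

End DemazureStep.

(* For i < 0 the roles of the rows and of the columns are exchanged. *)
Lemma f_closure_fits_neq0 (m : int) r c a b : conj_part r c -> r a = b -> c b = a ->
  (b%:Z = a%:Z + m)%R -> m != 0%R ->
  f_closure m [set A | fits r c (supp A)] =
  [set A | fits (incr a r) (incr b c) (supp A)].
Proof.
move=> rc ra cb bE m0; set neg := (m < 0)%R; set i := `|m|.
have i0 : 0 < i by rewrite absz_gt0.
have itE n L0 L : sorted le_kl L0 ->
    iter n (obind (f_pairs i)) (Some L0) = Some L ->
    sorted le_kl L /\
    iter n (obind (f_mat m)) (Some (of_pairs neg L0)) = Some (of_pairs neg L).
  move=> sL0; elim: n L => [|n IH] L /=; first by case=> <-.
  case E: (iter n _ _) => [L1|] //= fL1; have [sL1 ->] := IH _ E.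
  have [sL _] := f_pairs_raises sL1 fL1; split=> //=.
  by rewrite f_mat_of_pairs // -/i fL1.
have fwd L L' : sorted le_kl L -> f_pairs i L = Some L' ->
    fits (incr a r) (incr b c) (supp (of_pairs neg L)) ->
    fits (incr a r) (incr b c) (supp (of_pairs neg L')).
  move=> sL fL; rewrite !supp_of_pairs; case: ifP => m_lt0; last first.
    by apply: (f_pairs_fits rc ra cb _ i0 sL fL); lia.
  move=> /fits_swap; rewrite swap_setK => H; apply: fits_swap.
  apply: (f_pairs_fits (conj_part_sym rc) cb ra _ i0 sL fL); first by lia.
  exact: H.
have bwd L : sorted le_kl L ->
    fits (incr a r) (incr b c) (supp (of_pairs neg L)) -> exists n L0,
    [/\ sorted le_kl L0, fits r c (supp (of_pairs neg L0)) &
        iter n (obind (f_pairs i)) (Some L0) = Some L].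
  move=> sL; rewrite supp_of_pairs; case: ifP => m_lt0.
    move=> /fits_swap; rewrite swap_setK => H.
    have [|n [L0 [sL0 Lr L0n]]] := fits_f_pairs (conj_part_sym rc) cb ra _ i0 sL H.
      by lia.
    by exists n, L0; split; rewrite // supp_of_pairs; exact: fits_swap Lr.
  move=> H; have [|n [L0 [sL0 Lr L0n]]] := fits_f_pairs rc ra cb _ i0 sL H.
    by lia.
  by exists n, L0; rewrite supp_of_pairs.
apply/seteqP; split=> A /=; last first.
  have [L sL ->] := of_pairs_surj neg A.
  move=> /(bwd _ sL)[n [L0 [sL0 Lr /(itE _ _ _ sL0)[_ L0n]]]].
  by exists n, (of_pairs neg L0).
move=> [n [B [/(fits_incr a b)]]]; have [L0 sL0 ->] := of_pairs_surj neg B.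
move=> Br it; suff: exists2 L, sorted le_kl L &
    A = of_pairs neg L /\ fits (incr a r) (incr b c) (supp A).
  by case=> L _ [].
elim: n A it => [|n IH] A /=; first by case=> <-; exists L0.
case E: (iter n _ _) => [A1|] //=; have [L1 sL1 [-> L1r]] := IH _ E.
rewrite f_mat_of_pairs // -/i; case fL1: f_pairs => [L|] //= [<-].
have [sL _] := f_pairs_raises sL1 fL1.
by exists L => //; split=> //; exact: fwd fL1 L1r.
Qed.

(** f_0 only raises the entry at (1, 1), so A is reached from the matrix where this entry is
    erased. *)
Lemma f_closure_fits0 r c a : conj_part r c -> r a = a -> c a = a ->
  f_closure 0%R [set A | fits r c (supp A)] =
  [set A | fits (incr a r) (incr a c) (supp A)].
Proof.
move=> rc ra ca.
have itE n B : iter n (obind (f_mat 0%R)) (Some B) =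
    Some (msetD B (msetn n (1, 1))).
  elim: n => [|n IH] /=; first by rewrite msetn0 msetD0.
  rewrite IH /= /f_mat eqxx -msetDA; congr (Some (msetD _ _)).
  by apply/msetP => p; rewrite msetE2 !msetnE; case: eqP => //; rewrite addn1.
apply/seteqP; split=> A /=.
  move=> [n [B [/(fits_incr a a) Br]]]; rewrite itE => -[<-].
  apply: (fits_add11 rc ra ca erefl _ Br) => p.
  rewrite /supp /= msetE2 msetnE; case: (eqVneq p (1, 1)) => [->|_]; first by right.
  by rewrite addn0; left.
move=> Ar; exists (A (1, 1)), (msetB A (msetn (A (1, 1)) (1, 1))); split.
  apply: (fits_remove11 ra ca erefl) => /=.
    by rewrite /supp /= msetE2 msetnxx subnn.
  have BA : supp (msetB A (msetn (A (1, 1)) (1, 1))) `<=` supp A.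
    move=> q; rewrite /supp /= msetE2 -!lt0n => qB.
    exact: leq_trans qB (leq_subr _ _).
  move: Ar => [Apos Ar]; split=> [p /BA/Apos//|k p Bp].
  by apply: Ar; exact: chain_mono Bp.
rewrite itE; congr Some; apply/msetP => p; rewrite !msetE2 !msetnE.
by case: eqP => [->|_]; rewrite ?subn0 ?addn0 // subnK.
Qed.

Lemma f_closure_fits (m : int) r c a b : conj_part r c -> r a = b -> c b = a ->
  (b%:Z = a%:Z + m)%R ->
  f_closure m [set A | fits r c (supp A)] =
  [set A | fits (incr a r) (incr b c) (supp A)].
Proof.
move=> rc ra cb bE; have [m0|m0] := eqVneq m 0%R; last exact: f_closure_fits_neq0.
have ab : b = a by move: bE; rewrite m0; lia.
by rewrite ab in ra cb *; rewrite m0; exact: f_closure_fits0.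
Qed.

Lemma fits_empty : [set A | fits (fun=> 0) (fun=> 0) (supp A)] = [set mset0].
Proof.
apply/seteqP; split=> A /=.
  move=> [Apos Ar]; apply/msetP => p; rewrite mset0E; apply/eqP/negPn/negP => Ap.
  by have [] := Ar 0 p Ap; have [] := Apos p Ap; lia.
by move=> ->; split=> [p|[|k] p /=]; rewrite /supp /= mset0E // => -[].
Qed.

(** * The Weyl group as permutations of the integers *)

(* The order isomorphism Z -> Z^x; it turns s_i into the transposition of i - 1
   and i, for every i. *)
Definition zx_of (n : int) : zx := to_zx (if (n < 0)%R then n else n + 1)%R.

Definition int_of (j : zx) : int :=
  if (val j < 0)%R then val j else (val j - 1)%R.

Lemma val_zx_of n : val (zx_of n) = (if (n < 0)%R then n else n + 1)%R.
Proof. by rewrite /zx_of /to_zx insubdK //; case: ifP; lia. Qed.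

Lemma zx_ofK : cancel zx_of int_of.
Proof. by move=> n; rewrite /int_of val_zx_of; case: ifP; case: ifP; lia. Qed.

Lemma int_ofK : cancel int_of zx_of.
Proof.
move=> j; apply: val_inj; rewrite val_zx_of /int_of.
by have := valP j; case: ifP; case: ifP; lia.
Qed.

Lemma lt_zx_of m n : (val (zx_of m) < val (zx_of n))%R = (m < n)%R.
Proof. by rewrite !val_zx_of; case: ifP; case: ifP; lia. Qed.

Lemma root_indicesE i : root_indices i = (zx_of (i - 1)%R, zx_of i).
Proof.
have vE z : z != 0%R -> val (to_zx z) = z by move=> ?; rewrite /to_zx insubdK.
rewrite /root_indices; case: eqVneq => [->|i0].
  by congr pair; apply: val_inj; rewrite val_zx_of vE.
case: ifP => i_gt0; congr pair; apply: val_inj; rewrite val_zx_of vE;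
  do ?case: ifP; lia.
Qed.

Definition swap_at (p q x : int) : int :=
  if x == p then q else if x == q then p else x.

Definition swap_int (i : int) : int -> int := swap_at (i - 1)%R i.

Definition word_perm (s : seq int) (x : int) : int := foldr swap_int x s.

Lemma swap_atK p q : involutive (swap_at p q).
Proof.
move=> x; rewrite /swap_at; case: (eqVneq x p) => [->|xp].
  by rewrite eqxx; case: eqVneq.
case: (eqVneq x q) => [->|xq]; first by rewrite eqxx.
by rewrite (negbTE xp) (negbTE xq).
Qed.

Lemma swap_atC p q : swap_at p q =1 swap_at q p.
Proof.
move=> x; rewrite /swap_at; case: (eqVneq x p) => [->|//]; case: eqVneq => // ->.
Qed.

Lemma word_perm_cat s t x : word_perm (s ++ t) x = word_perm s (word_perm t x).
Proof. by rewrite /word_perm foldr_cat. Qed.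

Lemma word_permK s : cancel (word_perm s) (word_perm (rev s)).
Proof.
elim: s => [|i s IH] x //=.
by rewrite rev_cons -cats1 word_perm_cat /= [swap_int i _]swap_atK IH.
Qed.

Lemma word_perm_revK s : cancel (word_perm (rev s)) (word_perm s).
Proof. by move=> x; rewrite -{1}[s]revK word_permK. Qed.

Lemma swap_at_comm (g h : int -> int) p q x :
  cancel g h -> swap_at (g p) (g q) (g x) = g (swap_at p q x).
Proof.
move=> /can_inj gI; rewrite /swap_at !(inj_eq gI).
by case: eqP => // _; case: eqP.
Qed.

Lemma swap_int_perm s i x : swap_int i (word_perm s x) =
  word_perm s
    (swap_at (word_perm (rev s) (i - 1)%R) (word_perm (rev s) i) x).
Proof.
by rewrite -(swap_at_comm _ _ _ (word_permK s)) !word_perm_revK.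
Qed.

Lemma reflection_perm s i x : word_perm (s ++ i :: rev s) x =
  swap_at (word_perm s (i - 1)%R) (word_perm s i) x.
Proof.
rewrite word_perm_cat /= /swap_int -(swap_at_comm _ _ _ (word_permK s)).
by rewrite word_perm_revK.
Qed.

(* The exchange condition: some letter of the word must swap the images of p
   and q; deleting it composes the permutation with the transposition. *)
Lemma exchange s p q : (p < q)%R -> (word_perm s q < word_perm s p)%R ->
  exists2 t, size t < size s & word_perm t =1 word_perm s \o swap_at p q.
Proof.
move=> pq; elim: s => [|i s IH] /=; first by lia.
have [/IH [t ts tE]|lt_pq|E] := ltrgtP (word_perm s q) (word_perm s p).
- by exists (i :: t) => // x; rewrite /= tE.
- move=> H; have [pE qE] : word_perm s p = (i - 1)%R /\ word_perm s q = i.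
    by move: H; rewrite /swap_int /swap_at; do 4?[case: eqP => ?]; lia.
  exists s => // x /=; rewrite swap_int_perm.
  rewrite (_ : word_perm (rev s) (i - 1)%R = p); last by rewrite -pE word_permK.
  rewrite (_ : word_perm (rev s) i = q); last by rewrite -{1}qE word_permK.
  by rewrite swap_atK.
- by move: E => /(can_inj (word_permK s)); lia.
Qed.

(** * Length and minimal coset representatives *)

Section Weyl.
Variable R : realType.
Implicit Types (w u : weight R -> weight R) (s t : seq int).

(** Weights are transported along the permutation, which reduces identities between elements of W to
    identities between permutations. *)
Lemma word_reflE s (l : weight R) x :
  word_refl s l (zx_of (word_perm s x)) = l (zx_of x).
Proof.
elim: s x => [|i s IH] x //=; rewrite -IH; set y := word_perm s x.
rewrite /simple_refl /pairing_h /simple_root root_indicesE /=.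
set m := word_refl s l; rewrite /epsilon !(can_eq zx_ofK) /swap_int /swap_at.
case: (eqVneq y (i - 1)%R) => [->|y1].
  rewrite eqxx [i == _](_ : _ = false); last by apply/eqP; lia.
  by rewrite sub0r mulrN1 opprK addrC subrK.
case: (eqVneq y i) => [->|yi].
  rewrite eqxx [_ == i](_ : _ = false); last by apply/eqP; lia.
  by rewrite subr0 mulr1 opprB addrC subrK.
by rewrite (negbTE y1) (negbTE yi) subrr mulr0 subr0.
Qed.

Lemma eq_word_refl s t :
  word_refl s = word_refl t :> (weight R -> weight R) <->
  word_perm s =1 word_perm t.
Proof.
split=> [E x|E].
  have := word_reflE s (epsilon (zx_of x)) x.
  rewrite E -{1}[word_perm s x](word_perm_revK t) word_reflE /epsilon eqxx.
  case: eqP => [/(can_inj zx_ofK) H _|_ /eqP].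
    by rewrite -{2}H word_perm_revK.
  by rewrite eq_sym oner_eq0.
apply/funext => l; apply/funext => j.
by rewrite -[j]int_ofK -[int_of j](word_perm_revK s) word_reflE E word_reflE.
Qed.

Lemma word_refl_epsilon s x : word_refl s (epsilon (zx_of x)) =
  epsilon (zx_of (word_perm s x)) :> weight R.
Proof.
apply/funext => j; rewrite -[j]int_ofK -[int_of j](word_perm_revK s) word_reflE.
by rewrite /epsilon !(can_eq zx_ofK) (can_eq (word_permK s)).
Qed.

Lemma weyl_act_word s x :
  weyl_act (word_refl s : weight R -> weight R) (zx_of x) =
  zx_of (word_perm s x).
Proof.
rewrite /weyl_act; case: xgetP => [k _|/(_ _ (word_refl_epsilon s x))//] /=.
by rewrite word_refl_epsilon => /epsilon_inj.
Qed.

Lemma weyl_act_inv_word s x :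
  weyl_act_inv (word_refl s : weight R -> weight R) (zx_of x) =
  zx_of (word_perm (rev s) x).
Proof.
rewrite /weyl_act_inv; case: xgetP => [k _|] /=.
  rewrite -[k]int_ofK word_refl_epsilon => /epsilon_inj/(can_inj zx_ofK) <-.
  by rewrite word_permK.
move=> /(_ (zx_of (word_perm (rev s) x))) /=.
by rewrite word_refl_epsilon word_perm_revK.
Qed.

Lemma word_refl_cat s t :
  word_refl (s ++ t) = word_refl s \o word_refl t :> (weight R -> weight R).
Proof. by rewrite /word_refl; elim: s => //= i s ->. Qed.

(** [weyl_length] is chosen by [xget] with default 0, so the minimum has to be shown to exist. *)
Lemma weyl_lengthP w : weyl w ->
  (exists s, reduced_expr w s) /\
  forall s, w = word_refl s -> weyl_length w <= size s.
Proof.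
move=> [s0 w0]; pose P n := `[< exists2 s, w = word_refl s & size s = n >].
have exP : exists n, P n by exists (size s0); apply/asboolP; exists s0.
have [n /asboolP[s ws sn] nmin] := ex_minnP exP.
have [[t wt tn] tmin] : (exists2 t, w = word_refl t & size t = weyl_length w) /\
    (forall t, w = word_refl t -> weyl_length w <= size t).
  apply: (@xgetPex _ 0 [set n | (exists2 s, w = word_refl s & size s = n) /\
                  (forall s, w = word_refl s -> n <= size s)]).
  exists n; split; first by exists s.
  by move=> t wt; apply: nmin; apply/asboolP; exists t.
by split=> //; exists t.
Qed.

(** A reduced word of the element of t inverts p < q; the exchange condition shortens it to a word
    of the element of s. *)
Lemma weyl_length_swap_at s t p q : (p < q)%R ->
  (word_perm s p < word_perm s q)%R ->
  word_perm t =1 word_perm s \o swap_at p q ->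
  weyl_length (word_refl s : weight R -> weight R) <
  weyl_length (word_refl t : weight R -> weight R).
Proof.
move=> pq spq tE.
have [|[t' [tt' <-]] _] := @weyl_lengthP (word_refl t); first by exists t.
have t'E : word_perm t' =1 word_perm t by apply/eq_word_refl.
have [|v vt' vE] := @exchange t' p q pq.
  by rewrite !t'E !tE /= /swap_at !eqxx; case: eqP pq => [->|_ _//]; rewrite ltxx.
apply: leq_ltn_trans vt'.
have [|_] := @weyl_lengthP (word_refl s); first by exists s.
by apply; apply/eq_word_refl => x; rewrite vE /= t'E tE /= swap_atK.
Qed.

(** Right multiplication by s_j exchanges the values at j - 1 and j, so it increases the length
    exactly when these values increase. *)
Lemma weyl_minP s : weyl_min (word_refl s : weight R -> weight R) <->
  forall j : int, j != 0%R -> (word_perm s (j - 1)%R < word_perm s j)%R.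
Proof.
have E j : word_refl s \o simple_refl j = word_refl (rcons s j)
    :> (weight R -> weight R) by rewrite -cats1 word_refl_cat.
have pE j : word_perm (rcons s j) =1 word_perm s \o swap_at (j - 1)%R j.
  by move=> x; rewrite -cats1 word_perm_cat.
split=> [[_ smin] j j0|smin].
  have := smin _ j0; rewrite E ltnNge; case: ltrgtP => // H; last first.
    by move: H => /(can_inj (word_permK s)); lia.
  case/negP; apply/ltnW/(@weyl_length_swap_at _ _ (j - 1)%R j); first by lia.
    by rewrite !pE /= /swap_at !eqxx; case: ifP => //; lia.
  by move=> x; rewrite /= pE /= swap_atK.
split=> [|j j0]; first by exists s.
rewrite E; apply: (@weyl_length_swap_at _ _ (j - 1)%R j) => //; first by lia.
exact: smin.
Qed.

Lemma weyl_min_lt s p q : weyl_min (word_refl s : weight R -> weight R) ->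
  (p < q)%R -> (q < 0)%R || (0 <= p)%R -> (word_perm s p < word_perm s q)%R.
Proof.
move=> /weyl_minP smin pq; have -> : q = (p + (`|q - p|.-1).+1%:Z)%R by lia.
elim: (`|q - p|.-1) => [|n IH] Hq.
  have := smin (p + 1)%R; rewrite addrK; apply; lia.
apply: lt_trans (IH _) _; first by lia.
have := smin (p + n.+2%:Z)%R; rewrite (_ : p + n.+2%:Z - 1 = p + n.+1%:Z)%R.
  by apply; lia.
by lia.
Qed.

End Weyl.

(* The one-line notation of the Grassmannian permutation of a partition; row i
   and column j, counted from 0, belong to the positions - i - 1 and j. *)
Definition perm_shape (g : int -> int) (r c : nat -> nat) : Prop :=
  (forall i : nat, g (- i.+1%:Z) = (r i)%:Z - i.+1%:Z)%R /\
  (forall j : nat, g j%:Z = j%:Z - (c j)%:Z)%R.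

Lemma perm_shape_incr g h r c i p q : cancel g h -> conj_part r c ->
  perm_shape g r c -> (p < 0)%R -> (0 <= q)%R -> g p = (i - 1)%R -> g q = i ->
  exists a b : nat, [/\ p = (- a.+1%:Z)%R, q = (b%:Z)%R, r a = b, c b = a &
    (b%:Z = a%:Z + i)%R] /\
    perm_shape (swap_int i \o g) (incr a r) (incr b c).
Proof.
move=> /can_inj gI rc [gr gc] p0 q0 gp gq.
have [a pE] : exists a : nat, p = (- a.+1%:Z)%R by exists `|p|.-1; lia.
have [b qE] : exists b : nat, q = (b%:Z)%R by exists `|q|; lia.
have ga := gr a; have gb := gc b; rewrite -pE gp in ga; rewrite -qE gq in gb.
(* The values at p and q give r a = a + i and c b = b - i; the equivalence of b < r a and a < c b
   leaves only b = a + i. *)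
have rab := rc a b.
have [rab1 cab1] : r a = b /\ c b = a by split; lia.
exists a, b; split; first by split=> //; lia.
have neq (x y : nat) : (x%:Z == - y.+1%:Z)%R = false by lia.
rewrite /incr /swap_int /swap_at; split=> k /=.
  rewrite -gp (inj_eq gI) -gq (inj_eq gI) pE qE eqr_opp.
  case: (eqVneq k a) => [->|ka]; first by rewrite eqxx -qE gq; lia.
  rewrite [_ == (b%:Z)%R]eq_sym neq gr addn0; case: eqP => //; lia.
rewrite -gp (inj_eq gI) -gq (inj_eq gI) pE qE neq.
case: (eqVneq k b) => [->|kb]; first by rewrite eqxx -pE gp; lia.
by rewrite gc addn0; case: eqP => //; lia.
Qed.

(** * Demazure crystals and partitions *)

Section DemazureShape.
Variable R : realType.
Implicit Types (w u : weight R -> weight R) (s t : seq int).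

Lemma swap_int_lt i x y : (swap_int i x < swap_int i y)%R -> (y <= x)%R ->
  x = i /\ y = (i - 1)%R.
Proof.
move=> + yx; rewrite /swap_int /swap_at.
do 4?[case: eqP => ?] => H; split; lia.
Qed.

(** Induction on the word. Without its first letter s_i it is still reduced and minimal, with i - 1
    at a negative and i at a nonnegative position; putting s_i back adds a box of content i and
    closes the Demazure set under f_i. *)
Lemma reduced_shape s : weyl_min (word_refl s : weight R -> weight R) ->
  reduced_expr (word_refl s : weight R -> weight R) s ->
  exists r c, [/\ conj_part r c, perm_shape (word_perm s) r c &
    demazure s = [set A | fits r c (supp A)]].
Proof.
elim: s => [|i s IH] smin [_ slen].
  exists (fun=> 0), (fun=> 0); split=> //; last by rewrite fits_empty demazure_nil.
  by split=> k /=; lia.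
have [|[s' [ss' s'len]] slen_min] := @weyl_lengthP R (word_refl s).
  by exists s.
have slen' : size s = weyl_length (word_refl s : weight R -> weight R).
  apply/eqP; rewrite eqn_leq slen_min // andbT -s'len -ltnS.
  change (size (i :: s) < (size s').+2); rewrite slen ltnS.
  have [|_ /(_ (i :: s'))] := @weyl_lengthP R (word_refl (i :: s)).
    by exists (i :: s).
  by apply; rewrite /= -ss'.
have len_lt : weyl_length (word_refl s : weight R -> weight R) <
    weyl_length (word_refl (i :: s) : weight R -> weight R).
  by rewrite -slen -slen'.
pose p := word_perm (rev s) (i - 1)%R; pose q := word_perm (rev s) i.
have sp : word_perm s p = (i - 1)%R by rewrite word_perm_revK.
have sq : word_perm s q = i by rewrite word_perm_revK.
(* If i stood before i - 1, multiplying by s_i on the left would decrease the length. *)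
have pq : (p < q)%R.
  case: (ltgtP p q) => // [qp|pq]; last by move: sp; rewrite pq sq; lia.
  have : weyl_length (word_refl (i :: s) : weight R -> weight R) <
      weyl_length (word_refl s : weight R -> weight R).
    apply: (@weyl_length_swap_at R _ _ _ _ qp) => [|x].
      rewrite /= sp sq /swap_int /swap_at !eqxx; case: eqP; lia.
    by rewrite /= swap_int_perm -/p -/q (swap_atC q p) swap_atK.
  by move: len_lt; lia.
(* s_i reverses only the pair of values i - 1, i. A descent of [s] at j that it removes has i at j -
   1 and i - 1 at j, contrary to p < q. *)
have smin' : weyl_min (word_refl s : weight R -> weight R).
  apply/weyl_minP => j j0; rewrite ltNge; apply/negP => jge.
  have /weyl_minP /(_ j j0) /= /swap_int_lt /(_ jge) [] := smin.
  rewrite -{1}sq => /(can_inj (word_permK s)) jq.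
  by rewrite -sp => /(can_inj (word_permK s)); move: pq; rewrite -jq; lia.
have [r [c [rc sr sD]]] := IH smin' (conj erefl slen').
have ipq : (word_perm (i :: s) q < word_perm (i :: s) p)%R.
  by rewrite /= sp sq /swap_int /swap_at !eqxx; case: eqP; lia.
(* The word with s_i decreases from p to q, which minimality forbids for two positions on the same
   side of 0. *)
have [q0|q0] := ltP q 0%R.
  by have := @weyl_min_lt R _ _ _ smin pq; rewrite q0; move/(_ isT); lia.
have [p0|p0] := leP 0%R p.
  by have := @weyl_min_lt R _ _ _ smin pq; rewrite p0 orbT; move/(_ isT); lia.
have [a [b [[_ _ ra cb bE] sr']]] :=
  perm_shape_incr (word_permK s) rc sr p0 q0 sp sq.
exists (incr a r), (incr b c); split; [exact: conj_part_incr | exact: sr' |].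
by rewrite demazure_cons sD; exact: f_closure_fits.
Qed.

Definition young_of (r : nat -> nat) : set (nat * nat) :=
  diagram (fun i => r i.-1).

(** The elements counted are the values at the positions k with 0 <= k < r i: k - c k < r i - i - 1
    amounts to k < r i, and the negative positions after - i - 1 carry larger values. *)
Lemma lambda_weyl_shape s r c : conj_part r c -> perm_shape (word_perm s) r c ->
  lambda_weyl (word_refl s : weight R -> weight R) = young_of r.
Proof.
move=> rc [sr sc]; apply/seteqP.
suff E i : #|` fset_set [set j : zx |
    (- (i.+1%:Z) < val (weyl_act_inv (word_refl s : weight R -> weight R) j))%R /\
    (val j < val (weyl_act (word_refl s : weight R -> weight R)
       (to_zx (- (i.+1%:Z)))))%R]| = r i.
  split=> -[[|i] j]; rewrite /lambda_weyl /young_of /diagram /mkset ?E //=;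
    by case.
apply: card_fset_set.
set X := (X in (X #= _)%card).
have -> : X = (fun k : nat => zx_of (word_perm s k%:Z)) @` `I_(r i).
  have iE : to_zx (- i.+1%:Z) = zx_of (- i.+1%:Z) by [].
  have viE : (- i.+1%:Z)%R = val (zx_of (- i.+1%:Z)).
    by rewrite val_zx_of.
  apply/seteqP; rewrite /X iE; split=> [j /=|_ [k /= kr <-]]; last first.
    rewrite {1}viE weyl_act_inv_word weyl_act_word !lt_zx_of word_permK sr sc.
    by have := rc i k; lia.
  rewrite -[j]int_ofK weyl_act_inv_word weyl_act_word {1}viE !lt_zx_of.
  rewrite -{2 3}[int_of j](word_perm_revK s).
  case: (word_perm _ _) => [k|k]; rewrite ?NegzE !sr ?sc => -[H1 H2].
    by exists k => /=; [have := rc i k; lia | rewrite sc].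
  have ki : k <= i by lia.
  by have := conj_part_noninc rc ki; lia.
by apply: inj_card_eq => k l _ _ /(can_inj zx_ofK) /(can_inj (word_permK s)) [].
Qed.

End DemazureShape.

(** * The Bruhat order *)

Section Bruhat.
Variable R : realType.
Implicit Types (w u : weight R -> weight R) (s t : seq int).

Lemma weyl_min_shape s r c : conj_part r c -> perm_shape (word_perm s) r c ->
  weyl_min (word_refl s : weight R -> weight R).
Proof.
move=> rc [sr sc]; apply/weyl_minP => -[[|j]|j] // _.
  rewrite (_ : j.+1%:Z - 1 = j%:Z)%R; last by lia.
  by rewrite !sc; have := conj_part_noninc (conj_part_sym rc) (leqnSn j); lia.
rewrite NegzE (_ : - j.+1%:Z - 1 = - j.+2%:Z)%R; last by lia.
by rewrite !sr; have := conj_part_noninc rc (leqnSn j); lia.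
Qed.

(** The missing boxes are added one at a time, each by a left multiplication by a simple reflection
    that increases the length. *)
Lemma shape_bruhat s ru cu r c : conj_part ru cu ->
  perm_shape (word_perm s) ru cu -> conj_part r c -> (forall i, ru i <= r i) ->
  exists2 t, perm_shape (word_perm t) r c &
    bruhat (word_refl s : weight R -> weight R) (word_refl t).
Proof.
move=> ruc + rc; have r0 i : c 0 <= i -> r i = 0 by have := rc i 0; lia.
have [n le_n] := ubnP (\sum_(i < c 0) (r i - ru i)).
elim: n => // n IH in s ru cu ruc le_n *; rewrite ltnS in le_n.
move=> sru le_r; have [eq_r|] := pselect (forall i, ru i = r i).
  exists s; last exact: rt_refl.
  case: sru => sr sc; split=> [i|j]; first by rewrite sr eq_r.
  rewrite sc; congr (_ - Posz _)%R; apply/eqP; rewrite eqn_leq.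
  have := ruc (cu j) j; have := ruc (c j) j; rewrite !eq_r.
  by have := rc (cu j) j; have := rc (c j) j; rewrite !ltnn; lia.
move=> /existsNP[i0 /eqP ri0].
have ex : exists i, ru i < r i by exists i0; rewrite ltn_neqAle ri0 le_r.
have [a ra amin] := ex_minnP ex.
(* In the first row where the partitions differ a box can be added: the row above already has length
   r (a - 1) >= r a > ru a. *)
have cub : cu (ru a) = a.
  apply/eqP; rewrite eqn_leq [_ <= a]leqNgt -ruc ltnn /=.
  case: a ra amin => // a ra amin; rewrite -ruc ltnNge; apply/negP => le_a.
  have := amin a; have := conj_part_noninc rc (leqnSn a); lia.
pose b := ru a; pose i := (b%:Z - a%:Z)%R.
pose p := (- a.+1%:Z)%R; pose q := (b%:Z)%R.
have sp : word_perm s p = (i - 1)%R by rewrite sru.1 /i -/b; lia.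
have sq : word_perm s q = i by rewrite sru.2 /i cub.
have [//|//|a' [b' [[pE qE ra' cb' _] sru']]] :=
  perm_shape_incr (word_permK s) ruc sru _ _ sp sq.
have aE : a' = a by move: pE; rewrite /p; lia.
have bE : b' = b by move: qE; rewrite /q; lia.
rewrite aE bE in sru'.
have [||t tr st] := IH (i :: s) _ _ (conj_part_incr ruc erefl cub) _ sru'.
- apply: leq_trans le_n.
  have ac : a < c 0 by rewrite -rc; lia.
  rewrite (bigD1 (Ordinal ac)) //= [X in _ < X](bigD1 (Ordinal ac)) //=.
  rewrite /incr eqxx -addSn leq_add //; first by lia.
  by apply: leq_sum => k _; lia.
- move=> k; rewrite /incr; case: eqP => [->|_]; last by rewrite addn0.
  by rewrite addn1.
exists t => //; apply: rt_trans st; apply: rt_step; split.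
  have pq : (p < q)%R by rewrite /p /q; lia.
  apply: (@weyl_length_swap_at R _ _ _ _ pq) => [|x]; first by rewrite sp sq; lia.
  by rewrite /= swap_int_perm -sp -sq !word_permK.
(* A Bruhat step multiplies on the right, so s_i w is written as w (w^-1 s_i w). *)
exists (word_refl (rev s ++ i :: s)).
  by exists (rev s), i; rewrite revK.
rewrite -word_refl_cat; apply/eq_word_refl => x.
by rewrite !word_perm_cat word_perm_revK.
Qed.

(* A form of "at least as many negative positions carry values >= m", for all
   m, which makes sense although there may be infinitely many such positions. *)
Definition neg_positions_le (g h : int -> int) : Prop :=
  forall (m : int) (X : seq int), uniq X ->
    all (fun x => (x < 0)%R && (m <= g x)%R) X ->
    exists Y : seq int, [/\ uniq Y, size Y = size X &
      all (fun y => (y < 0)%R && (m <= h y)%R) Y].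

(** If X contains q but not p, q is moved to p, where h takes the value g q. Otherwise X itself
    serves: the value at p grows, and q inherits g p from a p that lies in X. *)
Lemma neg_positions_le_swap_at (g h : int -> int) p q : (p < q)%R ->
  (g p < g q)%R -> h =1 g \o swap_at p q -> neg_positions_le g h.
Proof.
move=> pq gpq hE m X uX /allP gX.
have [/andP[qX pX]|H] := boolP ((q \in X) && (p \notin X)).
  exists (map (swap_at p q) X); split; rewrite ?size_map //.
    by rewrite map_inj_uniq //; exact: inv_inj (swap_atK p q).
  apply/allP => _ /mapP[x xX ->]; rewrite hE /= swap_atK.
  have /andP[x0 ->] := gX _ xX; rewrite andbT /swap_at.
  case: eqP => [xp|_]; first by rewrite -xp xX in pX.
  by case: eqP => // xq; lia.
exists X; split=> //; apply/allP => x xX; have /andP[x0 mx] := gX _ xX.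
rewrite x0 hE /= /swap_at; case: eqP => [xp|_]; first by subst x; lia.
case: eqP => // xq; rewrite -xq xX /= negbK in H.
by case/andP: (gX _ H).
Qed.

Lemma bruhat_neg_positions_le u w s : bruhat u w -> u = word_refl s ->
  exists2 t, w = word_refl t & neg_positions_le (word_perm s) (word_perm t).
Proof.
move=> uw.
elim: {u w} uw s => [u w [uw [_ [v [i ->]] wE]]|u|u v w _ IH1 _ IH2] s us.
- rewrite {}wE {}us in uw *.
  exists (s ++ v ++ i :: rev v); first by rewrite -word_refl_cat.
  pose p := word_perm v (i - 1)%R; pose q := word_perm v i.
  have E : word_perm (s ++ v ++ i :: rev v) =1 word_perm s \o swap_at p q.
    by move=> x; rewrite word_perm_cat reflection_perm.
  (* The positions exchanged by the reflection come in either order; once they are ordered, the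
     growth of the length forces increasing values there. *)
  have main p' q' : (p' < q')%R -> swap_at p q =1 swap_at p' q' ->
      neg_positions_le (word_perm s) (word_perm (s ++ v ++ i :: rev v)).
    move=> pq' pqE.
    have E' : word_perm (s ++ v ++ i :: rev v) =1 word_perm s \o swap_at p' q'.
      by move=> x; rewrite E /= pqE.
    apply: (neg_positions_le_swap_at pq') => //.
    rewrite ltNge le_eqVlt negb_or -leNgt; apply/andP; split.
      by apply/eqP => /(can_inj (word_permK s)); lia.
    rewrite leNgt; apply/negP => H.
    have : weyl_length (word_refl (s ++ v ++ i :: rev v) : weight R -> weight R)
        < weyl_length (word_refl s : weight R -> weight R).
      apply: (@weyl_length_swap_at R _ _ _ _ pq') => [|x].
        by rewrite !E' /= /swap_at !eqxx; case: eqP => //; lia.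
      by rewrite /= E' /= swap_atK.
    by move: uw; rewrite -word_refl_cat; lia.
  case: (ltgtP p q) => [/main|/main|/(can_inj (word_permK v))]; [exact | | lia].
  by apply=> x; exact: swap_atC.
- by exists s => // m X uX gX; exists X.
- have [t vt st] := IH1 _ us; have [t' wt' tt'] := IH2 _ vt.
  exists t' => // m X uX /(st _ _ uX)[Y [uY <- /(tt' _ _ uY)]] //.
Qed.

(** If ru i > r i, then g reaches ru i - i - 1 at i + 1 negative positions, but h at no more than
    i. *)
Lemma neg_positions_le_shape g h ru cu r c : conj_part ru cu -> conj_part r c ->
  perm_shape g ru cu -> perm_shape h r c -> neg_positions_le g h ->
  forall i, ru i <= r i.
Proof.
move=> ruc rc [gr _] [hr _] gh i; rewrite leqNgt; apply/negP => ri.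
pose neg (k : nat) := (- k.+1%:Z)%R.
have neg_inj : injective neg by move=> k l; rewrite /neg; lia.
have [||Y [uY sY /allP hY]] :=
  gh ((ru i)%:Z - i.+1%:Z)%R (map neg (iota 0 i.+1)).
- by rewrite map_inj_uniq // iota_uniq.
- apply/allP => _ /mapP[k + ->]; rewrite mem_iota add0n ltnS /= /neg => ki.
  by rewrite gr; have := conj_part_noninc ruc ki; lia.
have : size Y <= size (map neg (iota 0 i)).
  apply: uniq_leq_size => // y /hY /andP[y0 hy]; apply/mapP.
  have yE : y = neg `|y|.-1 by rewrite /neg; lia.
  exists `|y|.-1 => //; rewrite mem_iota add0n /= ltnNge; apply/negP => iy.
  by move: hy; rewrite yE /neg hr; have := conj_part_noninc rc iy; lia.
by rewrite sY !size_map !size_iota ltnn.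
Qed.

Lemma bruhat_shape s t ru cu r c : conj_part ru cu -> conj_part r c ->
  perm_shape (word_perm s) ru cu -> perm_shape (word_perm t) r c ->
  bruhat (word_refl s : weight R -> weight R) (word_refl t) <->
  forall i, ru i <= r i.
Proof.
move=> ruc rc su tr; split=> [st|].
  have [t' /eq_word_refl tt' st'] := bruhat_neg_positions_le st erefl.
  apply: (neg_positions_le_shape ruc rc su _ st').
  by case: tr => tr tc; split=> k; rewrite -tt' ?tr ?tc.
move=> /(shape_bruhat ruc su rc)[t' t'r].
suff -> : word_refl t' = word_refl t :> (weight R -> weight R) by [].
apply/eq_word_refl => -[k|k]; rewrite ?NegzE.
  by rewrite t'r.2 tr.2.
by rewrite t'r.1 tr.1.
Qed.

End Bruhat.

(** * The partition of a finite set *)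

Lemma card_fset_seg n : #|` fset_set [set i | 0 < i <= n]| = n.
Proof.
apply: card_fset_set; have -> : [set i | 0 < i <= n] = succn @` `I_n.
  by apply/seteqP; split=> [[|i] // /andP[_ ?]|_ [i ? <-]//]; exists i.
by apply: inj_card_eq => i j _ _ [].
Qed.

(** The row and column lengths are the first indices at which [Q] fails. *)
Lemma conj_part_of_rel (Q : nat -> nat -> bool) M :
  (forall i j, Q i j -> i < M /\ j < M) ->
  (forall i j, Q i.+1 j -> Q i j) -> (forall i j, Q i j.+1 -> Q i j) ->
  exists r c, conj_part r c /\ forall i j, (j < r i) = Q i j.
Proof.
move=> QM Qi Qj.
have Qi' i i' j : i' <= i -> Q i j -> Q i' j.
  by move=> /subnK <-; elim: (i - i') => //= n IH /Qi/IH.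
have Qj' i j j' : j' <= j -> Q i j -> Q i j'.
  by move=> /subnK <-; elim: (j - j') => //= n IH /Qj/IH.
have exr i : exists j, ~~ Q i j.
  by exists M; apply/negP => /QM; rewrite ltnn => -[].
have exc j : exists i, ~~ Q i j.
  by exists M; apply/negP => /QM; rewrite ltnn => -[].
pose r i := ex_minn (exr i); pose c j := ex_minn (exc j).
have rQ i j : (j < r i) = Q i j.
  rewrite /r; case: ex_minnP => n nQ nmin; apply/idP/idP => [|ijQ].
    by apply: contraTT => /nmin; rewrite leqNgt.
  by rewrite ltnNge; apply: contra nQ => /Qj'; exact.
exists r, c; split=> // i j; rewrite rQ.
rewrite /c; case: ex_minnP => n nQ nmin; apply/idP/idP => [ijQ|].
  by rewrite ltnNge; apply: contra nQ => /Qi'; exact.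
by apply: contraTT => /nmin; rewrite leqNgt.
Qed.

Lemma young_ofP r p : young_of r p <-> [/\ 0 < p.1, 0 < p.2 & p.2.-1 < r p.1.-1].
Proof. by split=> [[p1 /andP[p2 H]]|[p1 p2 H]]; split=> //; lia. Qed.

Lemma young_of_sub r r' : young_of r `<=` young_of r' <-> forall i, r i <= r' i.
Proof.
split=> [rr' i|rr' p /young_ofP[p1 p2 H]]; last first.
  by apply/young_ofP; split=> //; apply: leq_trans H _.
case ri: (r i) => [//|n]; have /rr' /young_ofP[] // : young_of r (i.+1, n.+1).
by apply/young_ofP; split=> //=; rewrite ri.
Qed.

Lemma young_young_of r c : conj_part r c -> young (young_of r).
Proof.
move=> rc; exists (fun i => r i.-1) => //; split=> [i j i0 ij|].
  by apply: (conj_part_noninc rc); lia.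
by exists (c 0) => i ci; have := rc i.-1 0; lia.
Qed.

Lemma youngP D : young D -> exists r c, conj_part r c /\ D = young_of r.
Proof.
move=> [l [lmono [n ln]] ->].
have [|||r [c [rc rQ]]] :=
  @conj_part_of_rel (fun i j => j < l i.+1) (n + l 1).
- move=> i j ij; have := lmono 1 i.+1 isT isT; have := ln i.+1; lia.
- by move=> i j; have := lmono i.+1 i.+2 isT (leqnSn _); lia.
- by move=> i j; lia.
exists r, c; split=> //; apply/seteqP; split=> p.
  move=> [p1 /andP[p2 H]]; apply/young_ofP; rewrite rQ (prednK p1).
  by split=> //; lia.
by move=> /young_ofP[p1 p2]; rewrite rQ (prednK p1) => H; split=> //; lia.
Qed.

Section Frobenius.
Variables (r c : nat -> nat).
Hypothesis rc : conj_part r c.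

Lemma row_len_young i : row_len (young_of r) i.+1 = r i.
Proof.
rewrite /row_len -[RHS]card_fset_seg; congr #|` fset_set _|.
by apply/seteqP; split=> [j []|j] //=.
Qed.

Lemma col_len_young j : col_len (young_of r) j.+1 = c j.
Proof.
rewrite /col_len -[RHS]card_fset_seg; congr #|` fset_set _|.
apply/seteqP; split=> -[|i] //= => [/young_ofP[]//|/young_ofP[_ _]|ij].
  by rewrite /= rc.
by apply/young_ofP; rewrite /= rc.
Qed.

Lemma diag_len_young n : (forall i, (i < r i) = (i < n)) ->
  diag_len (young_of r) = n.
Proof.
move=> rn; rewrite /diag_len -[RHS]card_fset_seg; congr #|` fset_set _|.
apply/seteqP; split=> -[|i] //= => [/young_ofP[]//|/young_ofP[_ _]|i_n].
  by rewrite /= rn.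
by apply/young_ofP; rewrite /= rn.
Qed.

Lemma diag_len_youngE i : (i < r i) = (i < diag_len (young_of r)).
Proof.
(* The diagonal boxes form an initial segment, seen by treating them as a diagram with one column,
   whose length is c' 0. *)
have [|||r' [c' [rc' rQ]]] :=
  @conj_part_of_rel (fun i j => (i < r i) && (j == 0)) (c 0).+1.
- by move=> k j /andP[kr /eqP ->]; have := rc k 0; lia.
- move=> k j /andP[kr ->]; have := conj_part_noninc rc (leqnSn k); lia.
- by move=> k j; rewrite andbF.
have rn k : (k < r k) = (k < c' 0) by rewrite -rc' rQ andbT.
by rewrite (diag_len_young rn).
Qed.

(** Beyond the diagonal the default (0, 0) agrees with the truncated differences. *)
Lemma nth_frobenius k :
  nth (0, 0) (frobenius (young_of r)) k = (c k - k, r k - k).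
Proof.
have [kd|kd] := ltnP k (diag_len (young_of r)).
  rewrite (nth_map 0) ?size_iota // nth_iota // add1n col_len_young row_len_young.
  by move: kd; rewrite -diag_len_youngE => kr; have ck := rc k k; congr pair; lia.
rewrite nth_default ?size_map ?size_iota //.
move: kd; rewrite leqNgt -diag_len_youngE => kr; have ck := rc k k.
by congr pair; lia.
Qed.

End Frobenius.

Lemma finite_set_bound (S : set (nat * nat)) : finite_set S ->
  exists M, forall p, S p -> p.1 < M /\ p.2 < M.
Proof.
move=> /finite_seqP[s ->]; exists (\max_(p <- s) (p.1 + p.2)).+1 => p /= ps.
have le_max := @leq_bigmax_seq _ s xpredT (fun p => p.1 + p.2) p ps isT.
by rewrite !ltnS; split; apply: leq_trans le_max; rewrite ?leq_addr ?leq_addl.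
Qed.

Lemma smallest_young (S : set (nat * nat)) : finite_set S ->
  (forall p, S p -> 0 < p.1 /\ 0 < p.2) -> exists r c,
  [/\ conj_part r c, smallest young S = young_of r &
    forall i j, j < r i <-> exists2 q, S q & i < q.1 /\ j < q.2].
Proof.
move=> Sfin Spos; have [M SM] := finite_set_bound Sfin.
pose Q i j := `[< exists2 q, S q & i < q.1 /\ j < q.2 >].
have [|||r [c [rc rQ]]] := @conj_part_of_rel Q M.
- by move=> i j /asboolP[q /SM]; lia.
- by move=> i j /asboolP[q Sq H]; apply/asboolP; exists q => //; lia.
- by move=> i j /asboolP[q Sq H]; apply/asboolP; exists q => //; lia.
exists r, c; split=> // [|i j]; last by rewrite rQ; split=> /asboolP.
apply/seteqP; split.
  apply: smallest_sub; first exact: young_young_of rc.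
  move=> q Sq; have [q1 q2] := Spos _ Sq; apply/young_ofP; split=> //.
  by rewrite rQ; apply/asboolP; exists q => //; lia.
move=> p /young_ofP[p1 p2]; rewrite rQ => /asboolP[q Sq pq] D [[l [lmono _] ->] SD].
have [q1 /andP[q2 ql]] := SD _ Sq.
by split=> //; rewrite p2 /=; have := lmono p.1 q.1 p1; lia.
Qed.

Lemma corner_max (S : set (nat * nat)) : finite_set S ->
  (forall p, S p -> 0 < p.1 /\ 0 < p.2) -> S !=set0 -> forall n,
  (n < (corner S).1 <-> exists2 q, S q & n < q.1) /\
  (n < (corner S).2 <-> exists2 q, S q & n < q.2).
Proof.
move=> Sfin Spos [q0 Sq0] n; have [r [c [rc SE rS]]] := smallest_young Sfin Spos.
rewrite /corner SE -nth0 (nth_frobenius rc) !subn0 /= -(rc n 0) !rS.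
split; split=> -[q Sq H]; exists q => //; try lia.
  by have := Spos _ Sq; lia.
by have := Spos _ Sq; lia.
Qed.

(** A point survives a peeling exactly when some remaining point exceeds it strictly in both
    coordinates. *)
Lemma peelE (S : set (nat * nat)) k : finite_set S ->
  (forall p, S p -> 0 < p.1 /\ 0 < p.2) -> peel S k = [set p | chain S k p].
Proof.
move=> Sfin Spos; elim: k => [//|k]; rewrite /peel iterS => ->.
set T := [set p | chain S k p].
have TS : T `<=` S by move=> p; exact: chain_sub.
have [|r [c [rc TE rT]]] := @smallest_young T (sub_finite_set TS Sfin).
  by move=> p /TS/Spos.
rewrite /border_strip TE; apply/seteqP; split=> p.
  move=> [Tp /not_andP[]pH].
    case: pH; have [p1 p2] := Spos _ (TS _ Tp); apply/young_ofP; split=> //.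
    by apply/rT; exists p => //; lia.
  split; first exact: TS.
  by move/contrapT: pH => /young_ofP[_ _ /rT[q Tq pq]]; exists q.
move=> pk; split; first exact: chainS pk.
case: pk => [Sp [q Tq pq]] [_]; apply; apply/young_ofP; split=> //.
by apply/rT; exists q.
Qed.

(** [al k] and [be k] are the largest row and the largest column in which a chain of k + 1 points
    starts. They decrease strictly while positive, so they are the Frobenius coordinates of a
    partition. *)
Lemma lambda_setP (S : set (nat * nat)) : finite_set S ->
  (forall p, S p -> 0 < p.1 /\ 0 < p.2) -> exists r c,
  [/\ conj_part r c, lambda_set S = young_of r & forall k n,
    (n + k < c k <-> exists2 p, chain S k p & n < p.1) /\
    (n + k < r k <-> exists2 p, chain S k p & n < p.2)].
Proof.
move=> Sfin Spos; have [M SM] := finite_set_bound Sfin.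
have chainM k p : chain S k p -> p.1 + k < M /\ p.2 + k < M.
  elim: k p => [|k IH] p; first by rewrite !addn0 => /SM.
  by move=> [_ [q /IH]]; lia.
have pE k := peelE k Sfin Spos.
have peel_finite k : finite_set (peel S k).
  by apply: sub_finite_set Sfin; rewrite pE => p; exact: chain_sub.
have peel_pos k p : peel S k p -> 0 < p.1 /\ 0 < p.2.
  by rewrite pE => /chain_sub /Spos.
have [d0 dmin] : peel S (peel_depth S) = set0 /\
    forall k, peel S k = set0 -> peel_depth S <= k.
  apply: (@xgetPex _ 0 [set d | peel S d = set0 /\
    forall k, peel S k = set0 -> d <= k]).
  have ex : exists k, `[< peel S k = set0 >].
    by exists M; apply/asboolP; rewrite -subset0 pE => p /chainM; lia.
  have [d /asboolP dE dmin] := ex_minnP ex; exists d; split=> // k kE.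
  by apply: dmin; apply/asboolP.
set d := peel_depth S in d0 dmin.
pose F := [seq corner (peel S k) | k <- iota 0 d].
have chain_lt k p : chain S k p -> k < d.
  move=> pk; rewrite ltnNge; apply/negP => dk.
  suff : peel S d p by rewrite d0.
  rewrite pE /=; move: pk; rewrite -(subnK dk).
  by elim: (k - d) => // n IH /chainS.
have FE k n : (n < (nth (0, 0) F k).1 <-> exists2 p, chain S k p & n < p.1) /\
    (n < (nth (0, 0) F k).2 <-> exists2 p, chain S k p & n < p.2).
  have [kd|kd] := ltnP k d; last first.
    rewrite nth_default ?size_map ?size_iota //=.
    by split; split=> // -[p /chain_lt]; rewrite ltnNge kd.
  rewrite (nth_map 0) ?size_iota // nth_iota // add0n.
  have [|p1 p2] := @corner_max _ (peel_finite k) (@peel_pos k) _ n.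
    by apply/set0P/eqP => /dmin; rewrite leqNgt kd.
  by move: p1 p2; rewrite pE.
pose al k := (nth (0, 0) F k).1; pose be k := (nth (0, 0) F k).2.
have alP k n : n < al k <-> exists2 p, chain S k p & n < p.1 by case: (FE k n).
have beP k n : n < be k <-> exists2 p, chain S k p & n < p.2 by case: (FE k n).
have alS k n : n < al k.+1 -> n.+1 < al k.
  by move=> /alP[p [_ [q qk pq]] np]; apply/alP; exists q => //; lia.
have beS k n : n < be k.+1 -> n.+1 < be k.
  by move=> /beP[p [_ [q qk pq]] np]; apply/beP; exists q => //; lia.
have al_be k : (0 < al k) = (0 < be k).
  by apply/idP/idP => [/alP|/beP] [p pk _]; apply/alP || apply/beP; exists p => //;
    have := Spos _ (chain_sub pk); lia.
have al_d k : (0 < al k) = (k < d).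
  apply/idP/idP => [/alP[p /chain_lt//]|kd]; apply/alP.
  have : peel S k !=set0 by apply/set0P/eqP => /dmin; rewrite leqNgt kd.
  by rewrite pE => -[p pk]; exists p => //; have := Spos _ (chain_sub pk); lia.
(* The box (i, j) lies on the hook of the diagonal box of index [minn i j], i - j boxes down or j -
   i boxes to the right. *)
pose Q i j := (i - j < al (minn i j)) && (j - i < be (minn i j)).
have [|||r [c [rc rQ]]] := @conj_part_of_rel Q M.
- move=> i j /andP[/alP[p /chainM H1 H2] /beP[q /chainM H3 H4]]; lia.
- move=> i j; rewrite /Q; have [ij|ij] := leqP i.+1 j.
    rewrite (minn_idPl (ltnW ij)) => /andP[/alS H1 /beS H2].
    by apply/andP; split; lia.
  rewrite (minn_idPr (ij : j <= i)) => /andP[H1 H2].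
  by apply/andP; split; lia.
- move=> i j; rewrite /Q; have [ij|ij] := leqP j.+1 i.
    rewrite (minn_idPr (ltnW ij)) => /andP[/alS H1 /beS H2].
    by apply/andP; split; lia.
  rewrite (minn_idPl (ij : i <= j)) => /andP[H1 H2].
  by apply/andP; split; lia.
have rk k n : (n + k < r k) = (n < be k).
  rewrite rQ /Q (minn_idPl (leq_addl _ _)) addnK.
  rewrite (_ : k - (n + k) = 0); last by lia.
  by rewrite al_be; apply/andP/idP => [[]//|H]; split=> //; lia.
have ck k n : (n + k < c k) = (n < al k).
  rewrite -rc rQ /Q (minn_idPr (leq_addl _ _)) addnK.
  rewrite (_ : k - (n + k) = 0); last by lia.
  by rewrite -al_be; apply/andP/idP => [[]//|H]; split=> //; lia.
have FrE : frobenius (young_of r) = F.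
  apply: (@eq_from_nth _ (0, 0)) => [|k _].
    rewrite !size_map !size_iota; apply: diag_len_young => i.
    by have := rk i 0; rewrite add0n -al_be al_d.
  rewrite (nth_frobenius rc) [RHS]surjective_pairing -/(al k) -/(be k).
  by congr pair; apply/eqP; rewrite eqn_leq;
    have := ck k (al k); have := ck k (c k - k);
    have := rk k (be k); have := rk k (r k - k); lia.
(* The value chosen by [xget] is accessed only through its Frobenius coordinates, from which the
   claim is read off. *)
have [/youngP[r' [c' [rc' DE]]] DF] : young (lambda_set S) /\
    frobenius (lambda_set S) = F.
  apply: (@xgetPex _ set0 [set D | young D /\ frobenius D = F]).
  by exists (young_of r); split=> //; exact: young_young_of rc.
exists r', c'; split=> // k n; rewrite -alP -beP /al /be -DF DE.
by rewrite (nth_frobenius rc') /=; split; lia.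
Qed.

(** * Containment of partitions, chains and Bruhat order *)

Lemma lambda_set_fits (S : set (nat * nat)) r c : finite_set S ->
  (forall p, S p -> 0 < p.1 /\ 0 < p.2) -> conj_part r c ->
  lambda_set S `<=` young_of r <-> fits r c S.
Proof.
move=> Sfin Spos rc; have [r0 [c0 [rc0 -> H]]] := lambda_setP Sfin Spos.
rewrite young_of_sub; split=> [le_r|[_ Sr] i].
  split=> // k p pk; have [p1 p2] := Spos _ (chain_sub pk).
  have /(H k p.1.-1).1 : exists2 q, chain S k q & p.1.-1 < q.1.
    by exists p => //; lia.
  have /(H k p.2.-1).2 : exists2 q, chain S k q & p.2.-1 < q.2.
    by exists p => //; lia.
  rewrite -rc0 => H2 H1; have := le_r k; have := le_r (p.1.-1 + k).
  by have := rc (p.1.-1 + k) k; lia.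
suff lt_r j : j < r0 i -> j < r i by case: (r0 i) lt_r => // n; exact.
(* On or above the diagonal the box comes from a chain of i + 1 points and the bound on its column,
   below it from a chain of j + 1 points and the bound on its row. *)
have [ij|ji] := leqP i j.
  rewrite -[in j < r0 i](subnK ij) => /(H i _).2 [p pi jp].
  by have := Sr _ _ pi; lia.
rewrite rc0 -[in i < c0 j](subnK (ltnW ji)) => /(H j _).1 [p pj ip].
by rewrite rc; have := Sr _ _ pj; lia.
Qed.

Lemma supp_finite A : finite_set (supp A).
Proof.
apply: sub_finite_set (finite_seq (enum_mset A)) => p.
by rewrite /supp /= mset_neq0.
Qed.

Theorem theorem5p4 (R : realType) (w : weight R -> weight R) (s : seq int) :
  weyl_min w -> reduced_expr w s ->
  demazure s = [set A | calM A /\ lambda_set (supp A) `<=` lambda_weyl w] /\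
  demazure s = [set A | calM A /\ bruhat (w_set (supp A)) w].
Proof.
move=> wmin ws; have wE := ws.1; rewrite {}wE in wmin ws *.
have [r [c [rc sr ->]]] := reduced_shape wmin ws.
have fitsE : [set A | fits r c (supp A)] = [set A | calM A /\
    lambda_set (supp A) `<=` lambda_weyl (word_refl s : weight R -> weight R)].
  rewrite (lambda_weyl_shape _ rc sr); apply/seteqP; split=> A /=.
    move=> Ar; split; first exact: Ar.1.
    by apply/(lambda_set_fits (supp_finite A) Ar.1 rc).
  by move=> [Apos /(lambda_set_fits (supp_finite A) Apos rc)].
split=> //; rewrite fitsE (lambda_weyl_shape _ rc sr).
apply/seteqP; suff E A : calM A -> lambda_set (supp A) `<=` young_of r <->
    bruhat (w_set (supp A)) (word_refl s : weight R -> weight R).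
  by split=> A /= [Apos]; move: (E A Apos) => -[H1 H2]; split=> //; auto.
move=> Apos; have [r0 [c0 [rc0 lE _]]] := lambda_setP (supp_finite A) Apos.
have [umin uE] : weyl_min (w_set (supp A) : weight R -> weight R) /\
    lambda_weyl (w_set (supp A) : weight R -> weight R) = lambda_set (supp A).
  (* An element with partition lambda(S) exists: the empty shape of the identity is grown to it by
     [shape_bruhat]. *)
  apply: (@xgetPex _ _ [set u : weight R -> weight R | weyl_min u /\
    lambda_weyl u = lambda_set (supp A)]).
  have [|||t tr0 _] := @shape_bruhat R [::] (fun=> 0) (fun=> 0) r0 c0 _ _ rc0.
  - by [].
  - by split=> k /=; lia.
  - by [].
  exists (word_refl t); split; first exact: weyl_min_shape rc0 tr0.
  by rewrite (lambda_weyl_shape _ rc0 tr0).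
set u := w_set _ in umin uE *.
have [[t ut] _] := weyl_lengthP umin.1; have utE := ut.1.
rewrite {}utE in ut umin uE *; have [ru [cu [ruc tru _]]] := reduced_shape umin ut.
by rewrite -uE (lambda_weyl_shape _ ruc tru) young_of_sub bruhat_shape.
Qed.
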